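(* Consider $\min_{x,y}f(x_1,\dots,x_M)+\sum_{i=1}^Mg_i(x_i)+h(y)$ s.t. $Ax+By=b$ (where $Ax=\sum_iA_ix_i$), where $f$ is convex and differentiable, each $g_i$ is proper closed convex, $g=\sum_ig_i$ is strongly convex with modulus $\mu>0$, for every $S\subset\{1,\dots,M\}$ with $|S|=m$ the partial gradient $\nabla_Sf$ is Lipschitz continuous with a uniform constant $L_m$, $h$ is differentiable and strongly convex with modulus $\nu>0$ with $\nabla h$ Lipschitz continuous with constant $L_h$, and there exists a KKT point $z^*=(x^*,y^*,\lambda^* )$. Put $\theta=m/M$ and let $z^k=(x^k,y^k,\lambda^k)$, $k\ge1$, be generated by the randomized primal-dual block coordinate update method (see context) with $\rho=\theta\beta$. Let $0<\alpha<\theta$ and $\gamma=\max\left\{\frac{8\|A\|_2^2}{\alpha\mu},\frac{8\|B\|_2^2}{\alpha\nu}\right\}$. Assume that $B$ has full row rank and $\max\{\|A\|_2,\|B\|_2\}\le1$. Let $P=\eta_xI-\beta A^\top A$, $Q=\eta_yI-\beta B^\top B$. Choose $\delta,\kappa\ge0$ and positive numbers $\eta_x,\eta_y,c,\tau_1,\tau_2,\beta$ such that $$2\begin{bmatrix}1-(1-\theta)(1+\delta)&(1-\theta)(1+\delta)\\(1-\theta)(1+\delta)&\kappa-(1-\theta)(1+\delta)\end{bmatrix}\succeq\begin{bmatrix}\theta&1-\theta\\1-\theta&\frac1\theta-(1-\theta)\end{bmatrix},$$ $$P\succeq\beta(1-\theta)\tau_2A^\top A+L_mI,\qquad Q\succeq8cQ^\top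 Q+4c\rho^2(1-\theta)\big(1+\tfrac1\delta\big)B^\top BB^\top B+\beta\tau_1B^\top B,$$ and in addition $$\frac\alpha2\mu+\theta\mu>\frac\beta{\tau_1},\qquad \frac{3\alpha\nu}4>4cL_h^2+\frac{\beta(1-\theta)}{2\tau_2},\qquad \frac1\gamma>c\rho^2\Big(\kappa+2(1-\theta)\big(1+\tfrac1\delta\big)\Big)+2c(\beta-\rho)^2.$$ Then for every $k\ge1$, $$\psi(z^{k+1},z^*;P,Q,\beta,\rho,c,\tau_2)\le\frac1\eta\,\psi(z^k,z^*;P,Q,\beta,\rho,c,\tau_2),$$ where $$\eta=\min\Bigg\{\frac{1-\alpha}{1-\theta},\ 1+\frac{\frac\alpha2\mu+\theta\mu-\frac\beta{\tau_1}}{\eta_x+\mu(1-\theta)},\ 1+\frac{\frac{3\alpha\nu}4-4cL_h^2-\frac{\beta(1-\theta)}{2\tau_2}}{\frac{\eta_y}2+\frac{\beta(1-\theta)}{2\tau_2}},\ 1+\frac{\frac2\gamma-2c\rho^2\big(\kappa+2(1-\theta)(1+\frac1\delta)\big)-4c(\beta-\rho)^2}{\beta(1-\theta)},\ 1+c\rho\,\sigma_{\min}(BB^\top)\Bigg\}>1.$$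
   Context: $x=(x_1,\dots,x_M)$ has $M$ disjoint blocks, $A=[A_1,\dots,A_M]$, $F=f+g$; $g_i$ may be extended-valued. $\|\cdot\|_2$ is the spectral norm; $\sigma_{\min}(BB^\top)$ the smallest singular value of $BB^\top$; $\|v\|_W^2=v^\top Wv$. KKT point: $0\in\partial F(x^* )-A^\top\lambda^*$, $\nabla h(y^* )=B^\top\lambda^*$, $Ax^*+By^*=b$. Randomized primal-dual block coordinate update method: choose deterministic $(x^1,y^1)$, set $\lambda^1=0$, parameters $\beta,\rho,\eta_x,\eta_y>0$ and integer $1\le m\le M$; $r^1=Ax^1+By^1-b$, $\theta=m/M$. For $k=1,2,\dots$: select $S_k\subset\{1,\dots,M\}$, $|S_k|=m$, uniformly at random (independently of the past); $x_i^{k+1}=x_i^k$ for $i\notin S_k$ and $$x_i^{k+1}=\arg\min_{x_i}\langle\nabla_if(x^k)-A_i^\top(\lambda^k-\beta r^k),x_i\rangle+g_i(x_i)+\tfrac{\eta_x}2\|x_i-x_i^k\|^2\quad\text{for }i\in S_k;$$ $r^{k+\frac12}=r^k+\sum_{i\in S_k}A_i(x_i^{k+1}-x_i^k)$; independently, with probability $1-\theta$ set $y^{k+1}=y^k$, and with probability $\theta$ set $y^{k+1}=\tilde y^{k+1}$, where $$\tilde y^{k+1}=\arg\min_yh(y)-\langle B^\top(\lambda^k-\beta r^{k+\frac12}),y\rangle+\tfrac{\eta_y}2\|y-y^k\|^2;$$ $r^{k+1}=r^{k+\frac12}+B(y^{k+1}-y^k)$; $\lambda^{k+1}=\lambda^k-\rho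 r^{k+1}$. Definitions: $$\Psi(z^k,z^* )=F(x^k)-F(x^* )-\langle\tilde\nabla F(x^* ),x^k-x^*\rangle+\langle y^k-y^*,\nabla h(y^k)-\nabla h(y^* )\rangle,$$ where $\tilde\nabla F(x^* )=A^\top\lambda^*$ is the subgradient of $F$ at $x^*$ from the KKT conditions, and $$\psi(z^k,z^*;P,Q,\beta,\rho,c,\tau)=(1-\theta)\mathbb E\Psi(z^k,z^* )+\tfrac{\beta(1-\theta)}2\mathbb E\|r^k\|^2+\tfrac12\mathbb E\|x^k-x^*\|^2_{P+\mu(1-\theta)I}+\tfrac12\mathbb E\|y^k-y^*\|^2_{Q+\frac{\beta(1-\theta)}\tau B^\top B}$$ $$+\tfrac1{2\rho}\mathbb E\Big[\|\lambda^k-\lambda^*\|^2-(1-\theta)\|\lambda^{k-1}-\lambda^*\|^2+\tfrac1\theta\|\lambda^k-\lambda^{k-1}\|^2\Big].$$ Conventions: $\lambda^0:=\lambda^1+\rho r^1$; if $\theta<1$ then $\delta>0$ is required, while if $\theta=1$ then $\delta=0$ is allowed and $(1-\theta)(1+\frac1\delta)$ is read as $0$; entries of the minimum defining $\eta$ with denominator $0$ (when $\theta=1$) are read as $+\infty$; $0\cdot\infty=0$. *)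

(* Defs.v *)
From HB Require Import structures.
From mathcomp Require Export all_boot all_order all_algebra.
From mathcomp Require Export all_classical all_reals all_analysis.
Export Order.TTheory GRing.Theory Num.Theory.
Export numFieldNormedType.Exports.

Set Implicit Arguments.
Unset Strict Implicit.
Unset Printing Implicit Defensive.

Local Open Scope classical_set_scope.
Local Open Scope ring_scope.

Section Euclidean.
Context {R : realType}.

Definition inner {n} (u v : 'cV[R]_n) : R := (u^T *m v) 0 0.

(* The library norm `|v| on matrices is the sup norm, hence this definition. *)
Definition norm2 {n} (v : 'cV[R]_n) : R := Num.sqrt (inner v v).

(* The squared weighted norm v^T W v. *)
Definition wnormsq {n} (W : 'M[R]_n) (v : 'cV[R]_n) : R := inner v (W *m v).

Definition spectral_norm {m n} (C : 'M[R]_(m, n)) : R :=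
  sup [set norm2 (C *m v) | v in [set v : 'cV[R]_n | norm2 v <= 1]].

(* The singular values of C are the square roots of the eigenvalues of C^T C;
   the set is finite, and nonempty when n > 0, so this inf is then a minimum. *)
Definition sigma_min {n} (C : 'M[R]_n) : R :=
  inf [set s : R | 0 <= s /\ eigenvalue (C^T *m C) (s ^+ 2)].

(* The Loewner order X >= Y. *)
Definition psd {n} (X : 'M[R]_n) : Prop :=
  X^T = X /\ forall v : 'cV[R]_n, 0 <= wnormsq X v.

Definition psd_ge {n} (X Y : 'M[R]_n) : Prop := psd (X - Y).

Definition mx2 (a b c d : R) : 'M[R]_(1 + 1) :=
  block_mx a%:M b%:M c%:M d%:M.

Definition grad {n} (phi : 'cV[R]_n -> R) (v : 'cV[R]_n) : 'cV[R]_n :=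
  \col_i 'D_(delta_mx i 0) phi v.

Definition lipschitz2 {m n} (L : R) (G : 'cV[R]_m -> 'cV[R]_n) : Prop :=
  forall u v, norm2 (G u - G v) <= L * norm2 (u - v).

End Euclidean.

Section ConvexAnalysis.
Context {R : realType}.
Local Open Scope ereal_scope.

Definition proper {n} (phi : 'cV[R]_n -> \bar R) : Prop :=
  (forall v, phi v != -oo) /\ exists v, phi v \is a fin_num.

(* Only used for functions that never take the value -oo; as 0 * +oo = 0, the
   endpoints t = 0 and t = 1 impose nothing. *)
Definition econvex {n} (phi : 'cV[R]_n -> \bar R) : Prop :=
  forall (u v : 'cV[R]_n) (t : R), (0 <= t <= 1)%R ->
    phi (t *: u + (1 - t) *: v)%R <= t%:E * phi u + (1 - t)%:E * phi v.

Definition strongly_convex {n} (mu : R) (phi : 'cV[R]_n -> \bar R) : Prop :=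
  econvex (fun v => phi v - (mu / 2 * norm2 v ^+ 2)%:E).

Definition subdiff {n} (phi : 'cV[R]_n -> \bar R) (v : 'cV[R]_n) :
    set 'cV[R]_n :=
  [set xi | phi v \is a fin_num /\
            forall u, phi v + (inner xi (u - v)%R)%:E <= phi u].

Definition is_argmin {n} (phi : 'cV[R]_n -> \bar R) (u : 'cV[R]_n) : Prop :=
  forall v, phi u <= phi v.

End ConvexAnalysis.

Section Problem.
Context {R : realType} {M : nat} {n : 'I_M -> nat} {p q : nat}.
Local Notation N := (\sum_i n i)%N.
Variables (A : 'M[R]_(p, N)) (B : 'M[R]_(p, q)) (b : 'cV[R]_p).
Variables (f : 'cV[R]_N -> R) (g : forall i, 'cV[R]_(n i) -> \bar R).
Variable (h : 'cV[R]_q -> R).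

Definition gsum (x : 'cV[R]_N) : \bar R := (\sum_i g (submxcol x i))%E.

Definition objF (x : 'cV[R]_N) : \bar R := ((f x)%:E + gsum x)%E.

Definition is_KKT (xs : 'cV[R]_N) (ys : 'cV[R]_q) (ls : 'cV[R]_p) : Prop :=
  [/\ subdiff objF xs (A^T *m ls),
      grad h ys = B^T *m ls &
      A *m xs + B *m ys = b].

(* The blocks of v outside S replaced by 0. *)
Definition restrict_blocks (S : {set 'I_M}) (v : 'cV[R]_N) : 'cV[R]_N :=
  \mxcol_i (if i \in S then submxcol v i else 0).

(* Lipschitz continuity of the partial gradient in the block variables x_S,
   the other blocks being fixed, with one constant for all S of size m. *)
Definition partial_grad_lipschitz (m : nat) (L : R) : Prop :=
  forall S : {set 'I_M}, #|S| = m ->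
  forall x x' : 'cV[R]_N,
    (forall i, i \notin S -> submxcol x i = submxcol x' i) ->
    norm2 (restrict_blocks S (grad f x - grad f x')) <= L * norm2 (x - x').

(* The update rules, for every outcome w. The random choices of iteration
   k >= 1 are S k and the coin Y k, which decides whether y is updated; rh k is
   the residual r^(k+1/2). Of the values at index 0 only lam 0 matters. *)
Record rpdbcu (T : Type) (beta rho etax etay : R)
    (x1 : 'cV[R]_N) (y1 : 'cV[R]_q)
    (S : nat -> T -> {set 'I_M}) (Y : nat -> T -> bool)
    (x : nat -> T -> 'cV[R]_N) (y : nat -> T -> 'cV[R]_q)
    (lam r rh : nat -> T -> 'cV[R]_p) : Prop := {
  rpdbcu_x1 : forall w, x 1%N w = x1 ;
  rpdbcu_y1 : forall w, y 1%N w = y1 ;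
  rpdbcu_lam1 : forall w, lam 1%N w = 0 ;
  rpdbcu_r1 : forall w, r 1%N w = A *m x 1%N w + B *m y 1%N w - b ;
  rpdbcu_lam0 : forall w, lam 0%N w = lam 1%N w + rho *: r 1%N w ;
  rpdbcu_x_stay : forall k w i, (1 <= k)%N -> i \notin S k w ->
    submxcol (x k.+1 w) i = submxcol (x k w) i ;
  rpdbcu_x_update : forall k w i, (1 <= k)%N -> i \in S k w ->
    is_argmin (fun u : 'cV[R]_(n i) =>
        ((inner (submxcol (grad f (x k w)) i
                 - (submxrow A i)^T *m (lam k w - beta *: r k w)) u)%:E
         + g u
         + (etax / 2 * norm2 (u - submxcol (x k w) i) ^+ 2)%:E)%E)
      (submxcol (x k.+1 w) i) ;
  rpdbcu_r_half : forall k w, (1 <= k)%N ->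
    rh k w = r k w + \sum_(i in S k w)
      submxrow A i *m (submxcol (x k.+1 w) i - submxcol (x k w) i) ;
  rpdbcu_y_stay : forall k w, (1 <= k)%N -> ~~ Y k w -> y k.+1 w = y k w ;
  rpdbcu_y_update : forall k w, (1 <= k)%N -> Y k w ->
    is_argmin (fun u : 'cV[R]_q =>
        (h u - inner (B^T *m (lam k w - beta *: rh k w)) u
         + etay / 2 * norm2 (u - y k w) ^+ 2)%:E)
      (y k.+1 w) ;
  rpdbcu_r : forall k w, (1 <= k)%N ->
    r k.+1 w = rh k w + B *m (y k.+1 w - y k w) ;
  rpdbcu_lam : forall k w, (1 <= k)%N ->
    lam k.+1 w = lam k w - rho *: r k.+1 w }.

End Problem.

Section Probability.
Context {R : realType} {M : nat} d {T : measurableType d}.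
Variable (Pr : probability T R).

(* The choices (S k, Y k), k >= 1, are mutually independent, S k is uniform on
   the subsets of size m, and Y k is true with probability theta. In the
   product rule, E k and D k may be the full sets, so that it covers every
   finite subfamily. *)
Record sampling (m : nat) (theta : R)
    (S : nat -> T -> {set 'I_M}) (Y : nat -> T -> bool) : Prop := {
  sampling_measurable_S : forall k (E : set {set 'I_M}), (1 <= k)%N ->
    measurable (S k @^-1` E) ;
  sampling_measurable_Y : forall k (D : set bool), (1 <= k)%N ->
    measurable (Y k @^-1` D) ;
  sampling_card : forall k w, (1 <= k)%N -> #|S k w| = m ;
  sampling_uniform : forall k (s : {set 'I_M}), (1 <= k)%N -> #|s| = m ->
    Pr (S k @^-1` [set s]) = ('C(M, m)%:R^-1)%:E ;
  sampling_coin : forall k, (1 <= k)%N ->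
    Pr (Y k @^-1` [set true]) = theta%:E ;
  sampling_independent : forall (K : nat) (E : nat -> set {set 'I_M})
      (D : nat -> set bool),
    Pr (\bigcap_(k in [set k | (1 <= k <= K)%N])
          (S k @^-1` E k `&` Y k @^-1` D k)) =
    (\big[*%E/1]_(1 <= k < K.+1)
        (Pr (S k @^-1` E k) * Pr (Y k @^-1` D k)))%E }.

End Probability.

Section Lyapunov.
Context {R : realType} {M : nat} {n : 'I_M -> nat} {p q : nat}.
Local Notation N := (\sum_i n i)%N.
Variables (A : 'M[R]_(p, N)) (B : 'M[R]_(p, q)).
Variables (f : 'cV[R]_N -> R) (g : forall i, 'cV[R]_(n i) -> \bar R).
Variable (h : 'cV[R]_q -> R).
Variables (xs : 'cV[R]_N) (ys : 'cV[R]_q) (ls : 'cV[R]_p).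
Local Open Scope ereal_scope.

Definition Psi (xk : 'cV[R]_N) (yk : 'cV[R]_q) : \bar R :=
  objF f g xk - objF f g xs - (inner (A^T *m ls) (xk - xs)%R)%:E
  + (inner (yk - ys) (grad h yk - grad h ys))%:E.

Definition psi d (T : measurableType d) (Pr : probability T R)
    (x : nat -> T -> 'cV[R]_N) (y : nat -> T -> 'cV[R]_q)
    (lam r : nat -> T -> 'cV[R]_p) (theta mu : R)
    (P : 'M[R]_N) (Q : 'M[R]_q) (beta rho tau : R) (k : nat) : \bar R :=
  (1 - theta)%:E * \int[Pr]_w Psi (x k w) (y k w)
  + (beta * (1 - theta) / 2)%:E * 'E_Pr[(fun w => norm2 (r k w) ^+ 2)%R]
  + (2^-1)%:E *
    'E_Pr[(fun w => wnormsq (P + (mu * (1 - theta))%:M) (x k w - xs))%R]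
  + (2^-1)%:E *
    'E_Pr[(fun w => wnormsq (Q + (beta * (1 - theta) / tau) *: (B^T *m B))
                           (y k w - ys))%R]
  + ((2 * rho)^-1)%:E *
    'E_Pr[(fun w => norm2 (lam k w - ls) ^+ 2
                   - (1 - theta) * norm2 (lam k.-1 w - ls) ^+ 2
                   + theta^-1 * norm2 (lam k w - lam k.-1 w) ^+ 2)%R].

End Lyapunov.

(* Main.v *)
(* For a fixed history, put x~ for the point obtained by updating every block;
   the random x^{k+1} agrees with x~ on the blocks of S_k and with x^k
   elsewhere, so every blockwise separable quantity averages to theta (value at
   x~) + (1 - theta) (value at x^k). The partial Lipschitz bound and the
   strongly convex optimality of x~ then bound the average of F(x^{k+1}). For a
   fixed S_k the coin only involves the optimality condition of y~; the two
   cross terms <B(y^{k+1} - y^k), A(x^{k+1} - xs)> and <A(x^{k+1} - x^k), B(y^k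
   - ys)> are absorbed by Young's inequality with tau1 and tau2, and a fraction
   alpha of Psi(z^{k+1}) is spent on growing the quadratic terms by the factor
   eta. The multiplier term contracts because lambda_min(BB^T) |w|^2 <= |B^T
   w|^2 and, when y is updated, the optimality condition expresses B^T
   (lambda^{k+1} - ls) by the other terms. The state at step k is a function of
   the choices made so far (minimisers are unique), so all expectations are
   finite sums; if theta < 1 and F(x^k) is infinite somewhere, then psi at k is
   +oo and there is nothing to prove. *)

(* The coupling with y is handled for each draw separately, whereas the block estimate holds only on
   average over draws. A slack Z reconciles them: for a fixed draw the new objective gap is written
   exactly as the averaged bound plus Z, [coin_step] carries Z to its right-hand side, and averaging
   afterwards shows that the mean of Z is at most 0. Once the proximal terms are bounded through P
   and Q, and apart from growth by eta, the beta terms of that inequality collapse to a surplus beta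
   theta^2/2 |r^k|^2 and the two cross terms, with weights beta theta and beta (1 - theta); all
   terms in lam^k cancel. Hence tau1 takes room from Q and mu, and tau2 from P and from the B^T B
   weight in [psi]. The growth of the multiplier term has factor (eta - 1)/(2 rho) <= c sigma/2. If
   theta = 1, F(x^1) may be infinite while [psi] is finite: Psi has coefficient 0 there and every
   block is updated at once. This case stays in the main argument through alternatives starting with
   [theta = 1]. *)
Require Import Defs.
From mathcomp Require Import ring lra.

Set Implicit Arguments.
Unset Strict Implicit.
Unset Printing Implicit Defensive.

Local Open Scope classical_set_scope.
Local Open Scope ring_scope.

(** * Euclidean inner product and spectral norm *)

Section InnerProduct.
Context {R : realType}.
Implicit Types n : nat.

Lemma innerE n (u v : 'cV[R]_n) : inner u v = \sum_i u i 0 * v i 0.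
Proof. by rewrite /inner mxE; apply: eq_bigr => i _; rewrite mxE. Qed.

Lemma innerC n (u v : 'cV[R]_n) : inner u v = inner v u.
Proof. by rewrite !innerE; apply: eq_bigr => i _; rewrite mulrC. Qed.

Lemma innerDl n (u v w : 'cV[R]_n) : inner (u + v) w = inner u w + inner v w.
Proof. by rewrite /inner linearD mulmxDl mxE. Qed.

Lemma innerDr n (u v w : 'cV[R]_n) : inner w (u + v) = inner w u + inner w v.
Proof. by rewrite /inner mulmxDr mxE. Qed.

Lemma innerNl n (u v : 'cV[R]_n) : inner (- u) v = - inner u v.
Proof. by rewrite /inner linearN mulNmx mxE. Qed.

Lemma innerNr n (u v : 'cV[R]_n) : inner u (- v) = - inner u v.
Proof. by rewrite /inner mulmxN mxE. Qed.

Lemma innerBl n (u v w : 'cV[R]_n) : inner (u - v) w = inner u w - inner v w.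
Proof. by rewrite innerDl innerNl. Qed.

Lemma innerBr n (u v w : 'cV[R]_n) : inner w (u - v) = inner w u - inner w v.
Proof. by rewrite innerDr innerNr. Qed.

Lemma innerZl n a (u v : 'cV[R]_n) : inner (a *: u) v = a * inner u v.
Proof. by rewrite /inner linearZ -scalemxAl mxE. Qed.

Lemma innerZr n a (u v : 'cV[R]_n) : inner u (a *: v) = a * inner u v.
Proof. by rewrite /inner -scalemxAr mxE. Qed.

Lemma inner0l n (v : 'cV[R]_n) : inner 0 v = 0.
Proof. by rewrite /inner linear0 mul0mx mxE. Qed.

Lemma inner0r n (v : 'cV[R]_n) : inner v 0 = 0.
Proof. by rewrite innerC inner0l. Qed.

Definition innerL := (innerDl, innerDr, innerNl, innerNr, innerZl, innerZr).

Lemma inner_trmx k n (C : 'M[R]_(k, n)) u v :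
  inner (C^T *m u) v = inner u (C *m v).
Proof. by rewrite /inner trmx_mul trmxK mulmxA. Qed.

Lemma inner_ge0 n (v : 'cV[R]_n) : 0 <= inner v v.
Proof. by rewrite innerE; apply: sumr_ge0 => i _; rewrite -expr2 sqr_ge0. Qed.

Lemma inner_eq0 n (v : 'cV[R]_n) : (inner v v == 0) = (v == 0).
Proof.
apply/idP/eqP => [|->]; last by rewrite inner0l.
rewrite innerE psumr_eq0 => [/allP v0|i _]; last by rewrite -expr2 sqr_ge0.
apply/colP => i; rewrite mxE; apply/eqP.
by have := v0 i (mem_index_enum _); rewrite /= mulf_eq0 orbb.
Qed.

Lemma inner_gt0 n (v : 'cV[R]_n) : (0 < inner v v) = (v != 0).
Proof. by rewrite lt_def inner_ge0 andbT inner_eq0. Qed.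

Lemma inner_inj n (u v : 'cV[R]_n) : (forall w, inner u w = inner v w) -> u = v.
Proof.
move=> uv; apply/eqP; rewrite -subr_eq0 -inner_eq0.
by rewrite innerBl uv subrr.
Qed.

Lemma norm2_ge0 n (v : 'cV[R]_n) : 0 <= norm2 v.
Proof. exact: sqrtr_ge0. Qed.

Lemma norm2_sqr n (v : 'cV[R]_n) : norm2 v ^+ 2 = inner v v.
Proof. by rewrite sqr_sqrtr ?inner_ge0. Qed.

Lemma norm2Z n a (v : 'cV[R]_n) : norm2 (a *: v) = `|a| * norm2 v.
Proof.
by rewrite /norm2 innerZl innerZr mulrA -expr2 sqrtrM ?sqr_ge0// sqrtr_sqr.
Qed.

Lemma norm2_eq0 n (v : 'cV[R]_n) : (norm2 v == 0) = (v == 0).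
Proof. by rewrite -[LHS]sqrf_eq0 norm2_sqr inner_eq0. Qed.

Lemma young n (u v : 'cV[R]_n) t :
  0 < t -> 2 * inner u v <= t * inner u u + t^-1 * inner v v.
Proof.
move=> t0; have := inner_ge0 (t *: u - v); rewrite !innerL (innerC v u) => H.
rewrite -(ler_pM2l t0) mulrDr mulrA mulVKf ?gt_eqF//.
nra.
Qed.

Lemma cauchy_schwarz_sqr n (u v : 'cV[R]_n) :
  inner u v ^+ 2 <= inner u u * inner v v.
Proof.
have [->|v0] := eqVneq v 0; first by rewrite !inner0r expr0n mulr0.
have vv : 0 < inner v v by rewrite inner_gt0.
have := inner_ge0 (inner v v *: u - inner u v *: v).
rewrite !innerL (innerC v u).
move: (inner u u) (inner v v) (inner u v) vv => a b c b0 H.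
rewrite -(ler_pM2l b0); nra.
Qed.

Lemma cauchy_schwarz n (u v : 'cV[R]_n) : inner u v <= norm2 u * norm2 v.
Proof.
rewrite /norm2 -sqrtrM ?inner_ge0//.
apply: le_trans (ler_norm _) _.
by rewrite -sqrtr_sqr ler_sqrt ?mulr_ge0 ?inner_ge0// cauchy_schwarz_sqr.
Qed.

Lemma inner_sqrD n (u v : 'cV[R]_n) :
  inner (u + v) (u + v) <= 2 * inner u u + 2 * inner v v.
Proof.
by have := inner_ge0 (u - v); rewrite !innerL (innerC v u); lra.
Qed.

End InnerProduct.

Section SpectralNorm.
Context {R : realType} {k n : nat}.
Implicit Type C : 'M[R]_(k, n).

(** Cauchy-Schwarz on each row gives the Frobenius norm as K; it makes the supremum in
    [spectral_norm] a genuine one. *)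
Lemma mulmx_norm2_bounded C : exists2 K, 0 <= K &
  forall v, norm2 (C *m v) <= K * norm2 v.
Proof.
pose S := \sum_i inner (row i C)^T (row i C)^T.
have S0 : 0 <= S by apply: sumr_ge0 => i _; exact: inner_ge0.
exists (Num.sqrt S); first exact: sqrtr_ge0.
move=> v; rewrite /norm2 -sqrtrM// ler_sqrt ?mulr_ge0 ?inner_ge0//.
rewrite innerE mulr_suml; apply: ler_sum => i _.
have -> : (C *m v) i 0 = inner (row i C)^T v.
  by rewrite innerE mxE; apply: eq_bigr => j _; rewrite !mxE.
by rewrite -expr2 cauchy_schwarz_sqr.
Qed.

Lemma spectral_norm_has_sup C :
  has_sup [set norm2 (C *m v) | v in [set v : 'cV[R]_n | norm2 v <= 1]].
Proof.
split; first by exists (norm2 (C *m 0)), 0 => //=; rewrite /norm2 inner0l sqrtr0.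
have [K K0 CK] := mulmx_norm2_bounded C.
exists K => _ [v /= v1 <-]; apply: le_trans (CK v) _.
by rewrite -[leRHS]mulr1 ler_wpM2l.
Qed.

Lemma spectral_norm_ge0 C : 0 <= spectral_norm C.
Proof.
apply: le_trans (sup_upper_bound (spectral_norm_has_sup C) _); last first.
  by exists 0 => //=; rewrite /norm2 inner0l sqrtr0.
exact: norm2_ge0.
Qed.

Lemma norm2_mulmx_le C v : norm2 (C *m v) <= spectral_norm C * norm2 v.
Proof.
have [->|v0] := eqVneq v 0.
  by rewrite mulmx0 /norm2 !inner0l sqrtr0 mulr0.
have nv : 0 < norm2 v by rewrite lt_def norm2_ge0 norm2_eq0 v0.
rewrite -ler_pdivrMr//; apply: sup_upper_bound (spectral_norm_has_sup C) _ _.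
exists ((norm2 v)^-1 *: v) => /=.
  by rewrite norm2Z ger0_norm ?invr_ge0 ?norm2_ge0// mulVf ?gt_eqF.
by rewrite -scalemxAr norm2Z ger0_norm ?invr_ge0 ?norm2_ge0// mulrC.
Qed.

Lemma inner_mulmx_le C v :
  inner (C *m v) (C *m v) <= spectral_norm C ^+ 2 * inner v v.
Proof.
by rewrite -!norm2_sqr -exprMn ler_sqr ?nnegrE ?norm2_ge0 ?mulr_ge0
  ?spectral_norm_ge0 ?norm2_ge0 ?norm2_mulmx_le.
Qed.

Lemma inner_mulmx_le1 C v : spectral_norm C <= 1 ->
  inner (C *m v) (C *m v) <= inner v v.
Proof.
move=> C1; apply: le_trans (inner_mulmx_le C v) _.
by rewrite -[leRHS]mul1r ler_wpM2r ?inner_ge0// expr_le1 ?spectral_norm_ge0.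
Qed.

(** With v = C^T u, |v|^4 = <u, C v>^2 <= |u|^2 |C v|^2 <= |u|^2 |v|^2; dividing by |v|^2 transfers
    the bound from C to its transpose. *)
Lemma inner_trmx_mulmx_le1 C u : spectral_norm C <= 1 ->
  inner (C^T *m u) (C^T *m u) <= inner u u.
Proof.
move=> C1; set v := C^T *m u.
have vv : inner v v = inner u (C *m v) by rewrite {1}/v inner_trmx.
have := cauchy_schwarz_sqr u (C *m v); rewrite -vv => H.
have := inner_mulmx_le1 v C1 => H'.
have [|/ltW] := leP (inner v v) 0; first by move/le_trans; apply; exact: inner_ge0.
have := inner_ge0 u; nra.
Qed.

End SpectralNorm.

(** * The smallest singular value of a Gram matrix *)

Section SigmaMin.
Context {R : realType} {n : nat} (C : 'M[R]_n).
Hypothesis symC : C^T = C.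
Hypothesis posC : forall v, v != 0 -> 0 < inner v (C *m v).
Hypothesis n_gt0 : (0 < n)%N.

(** Row vectors, because [EVT_min_rV] and [bounded_closed_compact] are applied to them. *)
Let f (u : 'rV[R]_n) : R := inner u^T (C *m u^T).
Let g (u : 'rV[R]_n) : R := inner u^T u^T.

Let quad_continuous (D : 'M[R]_n) :
  continuous (fun u : 'rV[R]_n => inner u^T (D *m u^T)).
Proof.
rewrite (_ : (fun _ => _) = fun u : 'rV[R]_n => \sum_i u 0 i * \sum_j D i j * u 0 j).
  apply: continuous_big => [|i _ u]; first exact: add_continuous.
  apply: continuousM; first exact: coord_continuous.
  move: u; apply: continuous_big => [|j _ u]; first exact: add_continuous.
  by apply: continuousM; [exact: cst_continuous|exact: coord_continuous].
apply/funext => u; rewrite innerE; apply: eq_bigr => i _; rewrite !mxE.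
by congr (_ * _); apply: eq_bigr => j _; rewrite !mxE.
Qed.

Let sphere_compact : compact [set u | g u = 1].
Proof.
apply: bounded_closed_compact.
  exists 1; split; first exact: num_real.
  move=> x x1 u /= gu; apply: ltW; apply: le_lt_trans x1.
  rewrite /Num.Def.normr/= mx_normrE; apply: bigmax_le => // -[i j] _ /=.
  rewrite (ord1 i) -(@ler_pXn2r _ 2)// ?nnegrE// expr1n real_normK ?num_real//.
  rewrite -gu /g innerE (bigD1 j)//= !mxE -expr2 lerDl.
  by apply: sumr_ge0 => l _; rewrite -expr2 sqr_ge0.
have -> : [set u | g u = 1] = (fun u => g u) @^-1` [set 1 : R] by [].
apply: preimage_closed => [u _|]; last exact: closed_eq.
have := @quad_continuous 1%:M u.
by rewrite /g (_ : (fun u => inner u^T _) = (fun u : 'rV[R]_n => inner u^T u^T))//;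
  apply/funext => w; rewrite mul1mx.
Qed.

(** A minimiser of the quadratic form on the unit sphere exists by compactness, and stationarity
    makes it an eigenvector for the minimal value. *)
Lemma posdef_min_eigen : exists v0 : 'cV[R]_n,
  [/\ inner v0 v0 = 1, C *m v0 = inner v0 (C *m v0) *: v0 &
      forall v, inner v0 (C *m v0) * inner v v <= inner v (C *m v)].
Proof.
have ne : [set u | g u = 1] !=set0.
  exists (delta_mx 0 (Ordinal n_gt0)); rewrite /= /g innerE (bigD1 (Ordinal n_gt0))//=.
  rewrite !mxE !eqxx mulr1 big1 ?addr0// => i /negPf ni.
  by rewrite !mxE ni andbF mulr0.
have [u0 u01 minu] : exists2 c, c \in [set u | g u = 1] &
    forall t, t \in [set u | g u = 1] -> f c <= f t.
  by apply: EVT_min_rV ne sphere_compact _; exact/continuous_subspaceT/quad_continuous.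
pose v0 := u0^T; pose l := inner v0 (C *m v0).
have v01 : inner v0 v0 = 1 by move: u01; rewrite inE.
have lmin v : l * inner v v <= inner v (C *m v).
  have [->|v0'] := eqVneq v 0; first by rewrite mulmx0 !inner0r mulr0.
  have vv : 0 < norm2 v by rewrite lt_def norm2_ge0 norm2_eq0 v0'.
  have := minu ((norm2 v)^-1 *: v)^T.
  rewrite inE /= /g /f trmxK -scalemxAr !innerL -norm2_sqr.
  have -> : (norm2 v)^-1 * ((norm2 v)^-1 * norm2 v ^+ 2) = 1.
    by field; rewrite gt_eqF.
  move=> /(_ erefl); rewrite -/v0 -/l mulrA -expr2 exprVn mulrC.
  by rewrite ler_pdivlMr ?exprn_gt0.
exists v0; split=> //.
apply/eqP; rewrite -subr_eq0 -inner_eq0; set w := _ - _.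
(* perturbing the minimiser by t w changes the form by 2 t |w|^2 + O(t^2) *)
have symE u v : inner u (C *m v) = inner v (C *m u).
  by rewrite -{1}symC -inner_trmx trmxK innerC.
have wE : inner w (C *m v0) - l * inner w v0 = inner w w.
  by rewrite {4}/w innerBr innerZr.
clearbody w.
have Q t : 0 <= 2 * t * inner w w + t ^+ 2 * (inner w (C *m w) - l * inner w w).
  have := lmin (v0 + t *: w).
  rewrite mulmxDr -scalemxAr !innerL v01 -/l (innerC v0 w) (symE v0 w).
  rewrite -wE; set a := inner w (C *m v0); set b := inner w v0; lra.
move: Q (inner_ge0 w); set a := inner w w; set K := _ - _ => Q a0.
rewrite eq_le a0 andbT leNgt; apply/negP => a1.
pose D := 1 + `|K|; have D0 : 0 < D by rewrite /D ltr_pwDl.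
have KD : K <= D by rewrite /D; have := ler_norm K; lra.
(* As D >= K and D > 0, the value at this t is (a/D)^2 (K - 2D) < 0. *)
have := Q (- (a / D)).
have -> : 2 * - (a / D) * a + (- (a / D)) ^+ 2 * K = (a / D) ^+ 2 * (K - 2 * D).
  by field; rewrite gt_eqF.
rewrite leNgt => /negP; apply; rewrite pmulr_rlt0 ?exprn_gt0 ?divr_gt0//; lra.
Qed.

(** The infimum is the least eigenvalue l of C: l belongs to the set, and any s in it, with
    eigenvector v, has l |v|^2 <= <v, C v> <= |v| |C v| = s |v|^2. *)
Lemma sigma_min_posdef : 0 < sigma_min C /\
  forall v, sigma_min C * inner v v <= inner v (C *m v).
Proof.
have [v0 [v01 Cv0 lmin]] := posdef_min_eigen.
move: Cv0 lmin; set l := inner v0 _ => Cv0 lmin.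
have v0N0 : v0 != 0 by rewrite -inner_gt0 v01.
have l0 : 0 < l by exact: posC.
pose E := [set s : R | 0 <= s /\ eigenvalue (C^T *m C) (s ^+ 2)].
have El : E l.
  split; first exact: ltW.
  apply/eigenvalueP; exists v0^T; last by rewrite trmx_eq0.
  have e : v0^T *m C = l *: v0^T.
    by apply: trmx_inj; rewrite trmx_mul trmxK symC Cv0 linearZ /= trmxK.
  by rewrite symC mulmxA e -scalemxAl e scalerA -expr2.
have lbE : lbound E l.
  move=> s [s0 /eigenvalueP[v vE vN0]].
  have : inner (C *m v^T) (C *m v^T) = s ^+ 2 * inner v^T v^T.
    have vE' : C^T *m C *m v^T = s ^+ 2 *: v^T.
      by apply: trmx_inj; rewrite !trmx_mul !trmxK linearZ /= trmxK -vE.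
    by rewrite -inner_trmx mulmxA vE' innerZl.
  have vt0 : v^T != 0 by rewrite trmx_eq0.
  move=> CC; have := lmin v^T.
  have := cauchy_schwarz_sqr v^T (C *m v^T); rewrite CC.
  have vv : 0 < inner v^T v^T by rewrite inner_gt0.
  move=> h1 h2; rewrite -(@ler_pXn2r _ 2)// ?nnegrE ?(ltW l0)//.
  rewrite -(ler_pM2r (exprn_gt0 2 vv)) -exprMn.
  apply: le_trans (_ : inner v^T (C *m v^T) ^+ 2 <= _).
    by rewrite ler_pXn2r ?nnegrE// ?mulr_ge0 ?(ltW l0) ?(ltW vv)// (ltW (posC _)).
  by apply: le_trans h1 _; rewrite le_eqVlt; apply/orP; left; apply/eqP; ring.
have sl : sigma_min C <= l.
  by apply: ge_inf => //; exists l.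
split.
  by apply: lt_le_trans l0 _; apply: lb_le_inf => //; exists l.
move=> v; apply: le_trans (lmin v).
by rewrite ler_wpM2r ?inner_ge0.
Qed.

End SigmaMin.

(** Full row rank makes B^T injective, so the Gram matrix is positive definite. *)
Lemma sigma_min_gram {R : realType} (p q : nat) (B : 'M[R]_(p, q)) :
  (0 < p)%N -> row_free B ->
  0 < sigma_min (B *m B^T) /\
  forall v, sigma_min (B *m B^T) * inner v v <= inner (B^T *m v) (B^T *m v).
Proof.
move=> p0 fB.
have gramE v : inner v (B *m B^T *m v) = inner (B^T *m v) (B^T *m v).
  by rewrite inner_trmx mulmxA.
have [||//|sp sv] := @sigma_min_posdef R p (B *m B^T).
- by rewrite trmx_mul trmxK.
- move=> v v0; rewrite gramE inner_gt0; apply: contra_neq v0 => Bv.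
  apply: trmx_inj; rewrite trmx0; apply: (row_free_inj fB).
  by rewrite mul0mx -[B]trmxK -trmx_mul Bv trmx0.
- by split=> // v; rewrite -gramE.
Qed.

(** * Convexity, gradients and proximal steps *)

(** The limit t -> 0 of the hypothesis, in the form in which every first-order condition below is
    extracted. For a > 0 the choice t = a/(2D) would force 2D <= K, against K <= D. *)
Lemma le0_of_small {R : realType} (a K : R) :
  (forall t, 0 < t < 1 -> a <= t * K) -> a <= 0.
Proof.
move=> H; rewrite leNgt; apply/negP => a0.
pose D := 1 + a + `|K|; have D0 : 0 < D by rewrite /D; have := normr_ge0 K; lra.
have aD : a < D by rewrite /D; have := normr_ge0 K; lra.
have DD : 0 < D + D by rewrite addr_gt0.
have /H : 0 < a / (D + D) < 1.
  by rewrite divr_gt0//= ltr_pdivrMr//; lra.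
rewrite mulrAC ler_pdivlMr// ler_pM2l//.
by have := ler_norm K; have := normr_ge0 K; rewrite /D; lra.
Qed.

Section RealConvexity.
Context {R : realType} {n : nat}.
Implicit Types (u v w d x y z : 'cV[R]_n) (phi : 'cV[R]_n -> R).

(** Modulus 0 is convexity, so the smooth functions f and h share the lemmas below. *)
Definition convex_with_modulus (nu : R) phi := forall u w t, 0 <= t <= 1 ->
  phi (t *: u + (1 - t) *: w) <=
    t * phi u + (1 - t) * phi w - nu / 2 * (t * (1 - t)) * inner (u - w) (u - w).

Lemma derive_grad phi v d : differentiable phi v ->
  'D_d phi v = inner (grad phi v) d.
Proof.
move=> dphi; rewrite deriveE// {1}(matrix_sum_delta d) linear_sum innerE.
apply: eq_bigr => i _; rewrite big_ord1 linearZ mxE deriveE//=.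
by rewrite mulrC.
Qed.

(** A single step t suffices for comparing slopes; t < e makes a term t^2 K at most t e |K|, the
    size of the linearisation error. *)
Lemma derive_approx phi v d (e : R) : differentiable phi v -> 0 < e ->
  exists t, 0 < t < e /\
    `|phi (v + t *: d) - phi v - t * inner (grad phi v) d| <= t * e.
Proof.
move=> dphi e0; rewrite -derive_grad//.
have /cvgrPdist_lt/(_ _ e0) : derivable phi v d by exact: diff_derivable.
rewrite -/('D_d phi v) => /nbhs_ballP[r /= r0 H].
pose t := Num.min r e / 2.
have re0 : 0 < Num.min r e by rewrite lt_min r0.
have t0 : 0 < t by rewrite divr_gt0.
have tre : t < Num.min r e by rewrite ltr_pdivrMr//; lra.
move: tre; rewrite lt_min => /andP[tr te].
exists t; split; first by rewrite t0.
have := H t; rewrite /ball/= sub0r normrN gtr0_norm// => /(_ tr (lt0r_neq0 t0)).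
rewrite /shift/= [t *: d + v]addrC => /ltW Ht.
rewrite -(ler_pM2l t0) in Ht; apply: le_trans Ht.
rewrite -[X in _ <= X * _](gtr0_norm t0) -normrM mulrBr /GRing.scale/= mulrA mulfV ?gt_eqF//.
by rewrite mul1r distrC.
Qed.

Lemma grad_le phi v d (a K : R) : differentiable phi v ->
  (forall t, 0 < t < 1 -> phi (v + t *: d) - phi v <= t * a + t ^+ 2 * K) ->
  inner (grad phi v) d <= a.
Proof.
move=> dphi H; rewrite -subr_le0; apply: (@le0_of_small _ _ (1 + `|K|)).
move=> e /andP[e0 e1].
have [t [/andP[t0 te]]] := derive_approx d dphi e0.
rewrite ler_norml => /andP[lo _].
have /H : 0 < t < 1 by rewrite t0 (lt_trans te).
move: lo; set D := inner _ _; set q := _ - phi v => lo up.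
rewrite -(ler_pM2l t0).
have tK : t ^+ 2 * K <= t * (e * `|K|).
  rewrite expr2 -mulrA ler_pM2l//.
  apply: le_trans (_ : t * `|K| <= _); first by rewrite ler_pM2l// ler_norm.
  by rewrite ler_wpM2r// ltW.
lra.
Qed.

Lemma grad_ge phi v d (a K : R) : differentiable phi v ->
  (forall t, 0 < t < 1 -> t * a + t ^+ 2 * K <= phi (v + t *: d) - phi v) ->
  a <= inner (grad phi v) d.
Proof.
move=> dphi H; rewrite -subr_le0; apply: (@le0_of_small _ _ (1 + `|K|)).
move=> e /andP[e0 e1].
have [t [/andP[t0 te]]] := derive_approx d dphi e0.
rewrite ler_norml => /andP[_ up].
have /H : 0 < t < 1 by rewrite t0 (lt_trans te).
move: up; set D := inner _ _; set q := _ - phi v => up lo.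
rewrite -(ler_pM2l t0).
have tK : - (t * (e * `|K|)) <= t ^+ 2 * K.
  rewrite expr2 -mulrA -mulrN ler_pM2l//.
  apply: le_trans (_ : - (t * `|K|) <= _).
    by rewrite lerN2 ler_wpM2r// ltW.
  by rewrite -mulrN ler_pM2l// lerNl -normrN ler_norm.
lra.
Qed.

Lemma convex_grad_ineq nu phi u w : convex_with_modulus nu phi ->
  differentiable phi w ->
  phi w + inner (grad phi w) (u - w) + nu / 2 * inner (u - w) (u - w) <= phi u.
Proof.
move=> cphi dphi; set D := inner (u - w) (u - w).
suff : inner (grad phi w) (u - w) <= phi u - phi w - nu / 2 * D by lra.
(* Since t (1 - t) = t - t^2, the modulus contributes to the slope, and its t^2 part becomes the
   slack K. *)
apply: (@grad_le _ _ _ _ (nu / 2 * D)) => // t /andP[t0 t1].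
have -> : w + t *: (u - w) = t *: u + (1 - t) *: w.
  by rewrite scalerBr scalerBl scale1r addrCA.
have := cphi u w t; rewrite -/D (ltW t0) (ltW t1) => /(_ isT); lra.
Qed.

Lemma convex_grad_monotone nu phi u w : convex_with_modulus nu phi ->
  (forall v, differentiable phi v) ->
  nu * inner (u - w) (u - w) <= inner (u - w) (grad phi u - grad phi w).
Proof.
move=> cphi dphi.
have := convex_grad_ineq u cphi (dphi w).
have := convex_grad_ineq w cphi (dphi u).
set D := u - w; have -> : w - u = - D by rewrite opprB.
rewrite !(innerNl, innerNr) innerBr (innerC D (grad phi u)) (innerC D (grad phi w)).
lra.
Qed.

(** Minimality gives one inequality per direction d; using d and -d turns it into an equality. *)
Lemma prox_grad phi v y z (eta : R) : differentiable phi z ->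
  (forall u, phi z - inner v z + eta / 2 * inner (z - y) (z - y)
             <= phi u - inner v u + eta / 2 * inner (u - y) (u - y)) ->
  grad phi z = v - eta *: (z - y).
Proof.
move=> dphi opt.
have ge d : inner (v - eta *: (z - y)) d <= inner (grad phi z) d.
  apply: (@grad_ge _ _ _ _ (- (eta / 2 * inner d d))) => // t _.
  have := opt (z + t *: d).
  have -> : z + t *: d - y = (z - y) + t *: d by rewrite addrAC.
  move: (z - y) => a; rewrite !innerDl !innerDr !innerNl !innerZl !innerZr (innerC d a).
  lra.
apply: inner_inj => d; apply/eqP; rewrite eq_le ge andbT.
by have := ge (- d); rewrite !innerNr lerN2.
Qed.

Lemma convex_functionE phi : @convex_function R 'cV[R]_n setT phi ->
  convex_with_modulus 0 phi.
Proof.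
move=> cphi u w t t01.
have := cphi (Itv01 (proj1 (andP t01)) (proj2 (andP t01))) u w.
by move=> /(_ (mem_set I) (mem_set I)) H; rewrite !mul0r subr0; exact: H.
Qed.

(* Summing the gradient inequality over a subdivision of [x, x + d] into k steps
   gives the constant L / 2 * (k + 1) / k. *)
Lemma descent phi x d (L : R) : convex_with_modulus 0 phi ->
  (forall v, differentiable phi v) ->
  (forall t, 0 <= t <= 1 ->
     inner (grad phi (x + t *: d) - grad phi x) d <= L * t * inner d d) ->
  phi (x + d) <= phi x + inner (grad phi x) d + L / 2 * inner d d.
Proof.
move=> cphi dphi Lip; set D := inner d d; set G := inner (grad phi x) d.
have step (k : nat) : (0 < k)%N -> forall j, (j <= k)%N ->
    phi (x + (j%:R / k%:R) *: d) <=
      phi x + j%:R / k%:R * G + L / 2 * D * (j%:R * (j%:R + 1)) / k%:R ^+ 2.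
  move=> k0; have kR : 0 < k%:R :> R by rewrite ltr0n.
  elim=> [_|j IH jk].
    by rewrite mul0r scale0r addr0 !mul0r mulr0 mul0r !addr0.
  have := IH (ltnW jk).
  set s := j%:R / k%:R; set t := j.+1%:R / k%:R.
  have t01 : 0 <= t <= 1.
    by rewrite divr_ge0 ?ler0n//= ler_pdivrMr// mul1r ler_nat.
  (* The gradient is taken at the right end t = (j+1)/k, where [Lip] bounds its increase by L t
     |d|^2; the sum of (j+1)/k^2 yields (k+1)/(2k). *)
  have := convex_grad_ineq (x + s *: d) cphi (dphi (x + t *: d)).
  have -> : x + s *: d - (x + t *: d) = - (k%:R^-1 *: d).
    by apply/colP => i; rewrite !mxE /s /t -natr1; ring.
  rewrite !innerL !mul0r addr0 => H1 H2.
  have := Lip t t01; rewrite innerBl -/G -/D => H3.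
  have tE : t = s + k%:R^-1 by rewrite /s /t -natr1 mulrDl mul1r.
  have kV : 0 < k%:R^-1 :> R by rewrite invr_gt0.
  have H4 : k%:R^-1 * inner (grad phi (x + t *: d)) d <= k%:R^-1 * (G + L * t * D).
    by rewrite ler_pM2l//; lra.
  have -> : L / 2 * D * (j.+1%:R * (j.+1%:R + 1)) / k%:R ^+ 2 =
      L / 2 * D * (j%:R * (j%:R + 1)) / k%:R ^+ 2 + k%:R^-1 * (L * t * D).
    by rewrite /t -natr1; field; rewrite gt_eqF.
  have tG : t * G = s * G + k%:R^-1 * G by rewrite tE mulrDl.
  lra.
rewrite -subr_le0; apply: (@le0_of_small _ _ (`|L / 2 * D|)) => e /andP[e0 e1].
have [k ke] : exists k : nat, e^-1 < k%:R.
  by exists (Num.bound e^-1); apply: archi_boundP; rewrite invr_ge0 ltW.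
have kR : 0 < k%:R :> R by apply: lt_trans ke; rewrite invr_gt0.
have k0 : (0 < k)%N by rewrite -(ltr0n R).
have := step k k0 k (leqnn k); rewrite divff ?gt_eqF// scale1r mul1r.
have -> : L / 2 * D * (k%:R * (k%:R + 1)) / k%:R ^+ 2 =
  L / 2 * D + k%:R^-1 * (L / 2 * D) by field; rewrite gt_eqF.
have : k%:R^-1 * (L / 2 * D) <= e * `|L / 2 * D|.
  apply: le_trans (_ : k%:R^-1 * `|L / 2 * D| <= _).
    by rewrite ler_pM2l ?invr_gt0// ler_norm.
  by rewrite ler_wpM2r// -[leRHS]invrK lef_pV2 ?posrE ?invr_gt0// ltW.
lra.
Qed.

End RealConvexity.

Section ExtendedConvexity.
Context {R : realType} {n : nat}.
Implicit Types (u v w x z : 'cV[R]_n) (phi : 'cV[R]_n -> \bar R).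

Lemma econvex_strongly_convex0 phi : econvex phi -> strongly_convex 0 phi.
Proof.
move=> cphi; rewrite /strongly_convex (_ : (fun _ => _) = phi)//.
by apply/funext => v; rewrite mul0r mul0r sube0.
Qed.

(** Uses t |u|^2 + (1-t) |w|^2 - |t u + (1-t) w|^2 = t (1-t) |u - w|^2; the value at the
    intermediate point is finite, being bounded above and not -oo. *)
Lemma strongly_convex_fine mu phi u w t : (forall v, phi v != -oo%E) ->
  strongly_convex mu phi -> phi u \is a fin_num -> phi w \is a fin_num ->
  0 <= t <= 1 ->
  phi (t *: u + (1 - t) *: w) \is a fin_num /\
  fine (phi (t *: u + (1 - t) *: w)) <= t * fine (phi u) + (1 - t) * fine (phi w)
    - mu / 2 * (t * (1 - t)) * inner (u - w) (u - w).
Proof.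
move=> phiN cphi fu fw t01; have := cphi u w t t01.
rewrite !norm2_sqr -(fineK fu) -(fineK fw) -!EFinB -!EFinM -EFinD.
set z := t *: u + _; have := phiN z.
case: (phi z) => [a| |]//= _; rewrite -EFinB lee_fin => H; split=> //.
apply: le_trans (_ : t * (fine (phi u) - mu / 2 * inner u u)
   + (1 - t) * (fine (phi w) - mu / 2 * inner w w) + mu / 2 * inner z z <= _).
  by move: H; lra.
rewrite /z !innerL (innerC w u); lra.
Qed.

Lemma strongly_convex_real nu (h : 'cV[R]_n -> R) :
  strongly_convex nu (EFin \o h) -> convex_with_modulus nu h.
Proof.
move=> ch u w t t01.
by have [] := strongly_convex_fine (fun v => erefl : (EFin \o h) v != -oo%E) ch
  (erefl : (EFin \o h) u \is a fin_num) (erefl : (EFin \o h) w \is a fin_num) t01.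
Qed.

(** Says that -(v + eta (z - x)) is a subgradient at z with the extra strong convexity term.
    Comparing z with z + t (u - z), the proximal term changes its slope only, up to order t^2. *)
Lemma argmin_prox mu phi v x z (eta : R) : proper phi -> strongly_convex mu phi ->
  is_argmin (fun u => ((inner v u)%:E + phi u
    + (eta / 2 * norm2 (u - x) ^+ 2)%:E)%E) z ->
  phi z \is a fin_num /\ forall u, phi u \is a fin_num ->
    fine (phi z) - inner (v + eta *: (z - x)) (u - z)
      + mu / 2 * inner (u - z) (u - z) <= fine (phi u).
Proof.
move=> [phiN [u0 fu0]] cphi opt.
have fz : phi z \is a fin_num.
  have := opt u0; have := phiN z; rewrite -(fineK fu0) -!EFinD.
  by case: (phi z).
split=> // u fu; set D := inner (u - z) (u - z).
have wE t : t *: u + (1 - t) *: z = z + t *: (u - z).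
  by rewrite scalerBr scalerBl scale1r addrCA.
rewrite -subr_le0; apply: (@le0_of_small _ _ ((mu / 2 + eta / 2) * D)).
move=> t /andP[t0 t1].
have t01 : 0 <= t <= 1 by rewrite !ltW.
have := strongly_convex_fine phiN cphi fu fz t01; rewrite -/D wE => -[fw Hw].
have := opt (z + t *: (u - z)).
rewrite -(fineK fz) -(fineK fw) -!EFinD lee_fin !norm2_sqr.
have -> : z + t *: (u - z) - x = (z - x) + t *: (u - z) by rewrite addrAC.
move: Hw; rewrite /D; move: (fine (phi (z + t *: (u - z)))) => F.
move: (u - z) (z - x) => a e Hw.
rewrite !innerDl !innerDr !innerZl !innerZr (innerC a e) => H.
rewrite -(ler_pM2l t0); lra.
Qed.

(** Adding the optimality conditions of z and z', each tested at the other, leaves eta |z' - z|^2 <=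
    0. *)
Lemma argmin_prox_unique phi v x z z' (eta : R) : 0 < eta -> proper phi ->
  econvex phi ->
  is_argmin (fun u => ((inner v u)%:E + phi u
    + (eta / 2 * norm2 (u - x) ^+ 2)%:E)%E) z ->
  is_argmin (fun u => ((inner v u)%:E + phi u
    + (eta / 2 * norm2 (u - x) ^+ 2)%:E)%E) z' -> z = z'.
Proof.
move=> eta0 pphi /econvex_strongly_convex0 cphi.
move=> /(argmin_prox pphi cphi)[fz oz] /(argmin_prox pphi cphi)[fz' oz'].
have := oz _ fz'; have := oz' _ fz.
rewrite -(opprB z' z) !mul0r !addr0 innerNr => H1 H2.
have H3 : inner (v + eta *: (z - x)) (z' - z) - inner (v + eta *: (z' - x)) (z' - z)
   = - (eta * inner (z' - z) (z' - z)).
  by rewrite -innerBl -innerZl -innerNl; congr inner; apply/colP => i; rewrite !mxE; ring.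
have : eta * inner (z' - z) (z' - z) <= 0 by lra.
rewrite pmulr_rle0// => le0; apply/eqP; rewrite eq_sym -subr_eq0 -inner_eq0.
by rewrite eq_le le0 inner_ge0.
Qed.

End ExtendedConvexity.

(** * Random blocks *)

Section SubsetAverage.
Context {R : realType} {M : nat}.

(** The draws avoiding i are the m-subsets of the complement of i; Pascal's rule then leaves the
    binomial of M-1 over m-1 for those containing i. *)
Lemma card_draws_mem (m : nat) (i : 'I_M) : (0 < m)%N ->
  (M * #|[set s : {set 'I_M} | (#|s| == m) && (i \in s)]%SET| = m * 'C(M, m))%N.
Proof.
case: m => // m _; case: M i => [[]//|M'] i.
have := mul_bin_diag M'.+1 m; rewrite /= => <-; congr (_ * _)%N.
apply/eqP; rewrite -(eqn_add2r 'C(M', m.+1)) [X in _ == X]addnC -binS.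
have -> : 'C(M', m.+1) = #|[set s : {set 'I_M'.+1} | (#|s| == m.+1) && (i \notin s)]%SET|.
  rewrite -[M' in LHS]/(M'.+1.-1) -{1}(card_ord M'.+1) -(cardsC1 i) -cards_draws.
  apply: eq_card => s; rewrite !inE andbC; congr andb.
  by rewrite finset.subsetC finset.sub1set inE.
have := card_draws ('I_M'.+1) m.+1; rewrite card_ord => <-.
rewrite -[X in _ == X](cardsID [set s : {set 'I_M'.+1} | i \in s]).
by apply/eqP; congr (_ + _)%N; apply: eq_card => s; rewrite !inE// andbC.
Qed.

Lemma subset_sum_cst (m : nat) (a : R) :
  \sum_(s : {set 'I_M} | #|s| == m) a = 'C(M, m)%:R * a.
Proof.
rewrite sumr_const -[LHS]mulr_natl; congr (_%:R * _).
have := card_draws 'I_M m; rewrite card_ord => <-.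
by apply: eq_card => s; rewrite inE.
Qed.

(** A given block is drawn with probability m/M. *)
Lemma subset_average_if (m : nat) (i : 'I_M) (a b : R) : (1 <= m <= M)%N ->
  'C(M, m)%:R^-1 * (\sum_(s : {set 'I_M} | #|s| == m) if i \in s then a else b)
  = m%:R / M%:R * a + (1 - m%:R / M%:R) * b.
Proof.
move=> /andP[m0 mM].
have M0 : M%:R != 0 :> R by rewrite pnatr_eq0 -lt0n (leq_trans m0).
have C0 : 'C(M, m)%:R != 0 :> R by rewrite pnatr_eq0 -lt0n bin_gt0.
have -> : (\sum_(s : {set 'I_M} | #|s| == m) if i \in s then a else b) =
    #|[set s : {set 'I_M} | (#|s| == m) && (i \in s)]%SET|%:R * (a - b)
    + 'C(M, m)%:R * b.
  rewrite -subset_sum_cst -sum1_card natr_sum mulr_suml.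
  rewrite big_mkcond [X in _ = X + _]big_mkcond [X in _ = _ + X]big_mkcond -big_split.
  apply: eq_bigr => s _; rewrite inE.
  by case: (_ == m); case: (i \in s); rewrite /= ?mul1r ?subrK ?add0r ?addr0.
have -> : #|[set s : {set 'I_M} | (#|s| == m) && (i \in s)]%SET|%:R =
    m%:R * 'C(M, m)%:R / M%:R :> R.
  by rewrite -natrM -(card_draws_mem i m0) natrM mulrC mulKf.
by field; rewrite C0 M0.
Qed.

Lemma subset_average_sum_if (m : nat) (a b : 'I_M -> R) : (1 <= m <= M)%N ->
  'C(M, m)%:R^-1 *
    (\sum_(s : {set 'I_M} | #|s| == m) \sum_i if i \in s then a i else b i)
  = m%:R / M%:R * (\sum_i a i) + (1 - m%:R / M%:R) * (\sum_i b i).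
Proof.
move=> mM; rewrite exchange_big /= !mulr_sumr -big_split /=.
by apply: eq_bigr => i _; rewrite subset_average_if.
Qed.

Lemma subset_average_cst (m : nat) (a : R) : (m <= M)%N ->
  'C(M, m)%:R^-1 * (\sum_(s : {set 'I_M} | #|s| == m) a) = a.
Proof.
by move=> mM; rewrite subset_sum_cst mulKf// pnatr_eq0 -lt0n bin_gt0.
Qed.

End SubsetAverage.

(** * Separable functions of block vectors and the averaged proximal step *)

Section Blocks.
Context {R : realType} {M : nat} {n : 'I_M -> nat}.
Local Notation N := (\sum_i n i)%N.

Lemma inner_blocks (u v : 'cV[R]_N) :
  inner u v = \sum_i inner (submxcol u i) (submxcol v i).
Proof.
rewrite /inner -{1}(submxcolK u) -{1}(submxcolK v) tr_mxcol mul_mxrow_mxcol.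
by rewrite summxE.
Qed.

Lemma mulmx_blocks p (A : 'M[R]_(p, N)) (v : 'cV[R]_N) :
  A *m v = \sum_i submxrow A i *m submxcol v i.
Proof.
by rewrite -{1}(submxrowK A) -{1}(submxcolK v) mul_mxrow_mxcol.
Qed.

(** The next iterate for the draw s, when z is the point with every block updated. *)
Definition replace_blocks (s : {set 'I_M}) (x z : 'cV[R]_N) : 'cV[R]_N :=
  \mxcol_i (if i \in s then submxcol z i else submxcol x i).

Lemma submxcol_replace s x z i : submxcol (replace_blocks s x z) i =
  if i \in s then submxcol z i else submxcol x i.
Proof. exact: mxcolK. Qed.

Lemma replace_blocks_sub s x z i :
  submxcol (replace_blocks s x z - x) i =
  if i \in s then submxcol (z - x) i else 0.
Proof.
by rewrite submxcolB submxcol_replace; case: ifP => _; rewrite ?subrr// submxcolB.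
Qed.

(** The displacement is supported on s, so its inner product with a gradient difference sees only
    the blocks that [partial_grad_lipschitz] controls. *)
Lemma partial_descent (f : 'cV[R]_N -> R) m L (s : {set 'I_M}) (x z : 'cV[R]_N) :
  convex_with_modulus 0 f -> (forall v, differentiable f v) ->
  partial_grad_lipschitz f m L -> #|s| = m ->
  forall x', x' = replace_blocks s x z ->
  f x' <= f x + inner (grad f x) (x' - x) + L / 2 * inner (x' - x) (x' - x).
Proof.
move=> cf df Lf sm x' x'E.
rewrite -{1}(subrK x x') addrC; apply: descent => // t /andP[t0 t1].
have off i : i \notin s -> submxcol (x' - x) i = 0.
  by move=> /negPf si; rewrite x'E replace_blocks_sub si.
have := Lf s sm (x + t *: (x' - x)) x.
have eqo i : i \notin s -> submxcol (x + t *: (x' - x)) i = submxcol x i.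
  move=> si; rewrite submxcolD.
  have -> : submxcol (t *: (x' - x)) i = t *: submxcol (x' - x) i.
    by apply/matrixP => a b; rewrite !mxE.
  by rewrite off// scaler0 addr0.
move=> /(_ eqo); set G := grad f _ - grad f x.
have -> : x + t *: (x' - x) - x = t *: (x' - x) by rewrite addrC addKr.
have -> : inner G (x' - x) = inner (restrict_blocks s G) (x' - x).
  rewrite !inner_blocks; apply: eq_bigr => i _; rewrite mxcolK.
  by case: ifPn => // /off ->; rewrite !inner0r.
move=> H; apply: le_trans (cauchy_schwarz _ _) _.
rewrite -[inner (x' - x) _]norm2_sqr expr2 mulrA ler_wpM2r ?norm2_ge0//.
by apply: le_trans H _; rewrite norm2Z ger0_norm// mulrA.
Qed.

Section Objective.
Variables (f : 'cV[R]_N -> R) (g : forall i, 'cV[R]_(n i) -> \bar R).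
Hypothesis g_proper : forall i, proper (@g i).

Definition in_domain (x : 'cV[R]_N) := forall i, g (submxcol x i) \is a fin_num.

(* Blockwise [fine], so that the sum stays separable even at a point x where
   some g_i is infinite; it is g x only for x in the domain. *)
Definition gval (x : 'cV[R]_N) : R := \sum_i fine (g (submxcol x i)).

Lemma gsum_in_domain x : in_domain x -> gsum g x = (gval x)%:E.
Proof.
by move=> dx; rewrite /gsum /gval -sumEFin; apply: eq_bigr => i _; rewrite fineK.
Qed.

Lemma gsum_notin_domain x : ~ in_domain x -> gsum g x = +oo%E.
Proof.
move=> /existsNP[i /negP gi]; apply/eqP; rewrite /gsum esum_eqy => [|j _].
  apply/existsP; exists i; move: gi (proj1 (g_proper i) (submxcol x i)).
  by case: (g _).
exact: (proj1 (g_proper j)).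
Qed.

Lemma gsum_fin_num x : gsum g x \is a fin_num <-> in_domain x.
Proof.
split=> [|/gsum_in_domain->//].
by have [//|/gsum_notin_domain->] := pselect (in_domain x).
Qed.

Lemma gsum_neq_ninfty x : gsum g x != -oo%E.
Proof.
by have [/gsum_in_domain->|/gsum_notin_domain->] := pselect (in_domain x).
Qed.

Lemma gsum_proper : proper (gsum g).
Proof.
split; first exact: gsum_neq_ninfty.
exists (\mxcol_i sval (cid (proj2 (g_proper i)))); apply/gsum_fin_num => i.
by rewrite mxcolK; exact: (svalP (cid (proj2 (g_proper i)))).
Qed.

Lemma objF_in_domain x : in_domain x -> objF f g x = (f x + gval x)%:E.
Proof. by move=> /gsum_in_domain gx; rewrite /objF gx. Qed.

Lemma objF_notin_domain x : ~ in_domain x -> objF f g x = +oo%E.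
Proof. by move=> /gsum_notin_domain gx; rewrite /objF gx. Qed.

Lemma subdiff_in_domain x xi : subdiff (objF f g) x xi -> in_domain x.
Proof.
by case=> + _; have [//|/objF_notin_domain->] := pselect (in_domain x).
Qed.

(** Upgrades the subgradient of the KKT condition by the modulus of g: test it at x + t (z - x),
    divide by t, let t tend to 0. *)
Lemma subdiff_strong mu x xi z : convex_with_modulus 0 f ->
  strongly_convex mu (gsum g) -> subdiff (objF f g) x xi -> in_domain z ->
  f x + gval x + inner xi (z - x) + mu / 2 * inner (z - x) (z - x) <= f z + gval z.
Proof.
move=> cf cg sub dz; have dx := subdiff_in_domain sub.
have [_ le_sub] := sub; set D := inner (z - x) (z - x).
rewrite -subr_le0; apply: (@le0_of_small _ _ (mu / 2 * D)) => t /andP[t0 t1].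
have t01 : 0 <= t <= 1 by rewrite !ltW.
have [fw] := strongly_convex_fine gsum_neq_ninfty cg (proj2 (gsum_fin_num z) dz)
  (proj2 (gsum_fin_num x) dx) t01.
have := cf z x t t01; rewrite mul0r !mul0r subr0 -/D.
have wE : t *: z + (1 - t) *: x = x + t *: (z - x).
  by rewrite scalerBr scalerBl scale1r addrCA.
have := le_sub (t *: z + (1 - t) *: x).
move/gsum_fin_num: fw => dw.
have -> : t *: z + (1 - t) *: x - x = t *: (z - x) by rewrite wE addrC addKr.
rewrite !objF_in_domain// !gsum_in_domain//= innerZr.
rewrite -EFinD lee_fin => H1 H2 H3; rewrite -(ler_pM2l t0); lra.
Qed.

(** The modulus mu belongs to the sum g, so the block problems are glued into one proximal problem
    for [gsum]. *)
Lemma argmin_blocks (a x z : 'cV[R]_N) (eta : R) :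
  (forall i, is_argmin (fun u => ((inner (submxcol a i) u)%:E + g u
     + (eta / 2 * norm2 (u - submxcol x i) ^+ 2)%:E)%E) (submxcol z i)) ->
  is_argmin (fun u => ((inner a u)%:E + gsum g u
     + (eta / 2 * norm2 (u - x) ^+ 2)%:E)%E) z.
Proof.
move=> opt u.
have E w : ((inner a w)%:E + gsum g w + (eta / 2 * norm2 (w - x) ^+ 2)%:E =
  \sum_i ((inner (submxcol a i) (submxcol w i))%:E + g (submxcol w i)
     + (eta / 2 * norm2 (submxcol w i - submxcol x i) ^+ 2)%:E))%E.
  rewrite !big_split /= !sumEFin inner_blocks norm2_sqr inner_blocks mulr_sumr.
  congr (_ + _ + _%:E)%E; apply: eq_bigr => i _.
  by rewrite norm2_sqr submxcolB.
by rewrite !E; apply: lee_sum => i _; exact: opt.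
Qed.

(** The quadratic terms stay under the average on the left because [coin_step] needs them draw by
    draw. *)
Lemma block_step_average m mu L (eta : R) p (A : 'M[R]_(p, N)) (v : 'cV[R]_p)
    (x xs z : 'cV[R]_N) :
  (1 <= m <= M)%N -> convex_with_modulus 0 f -> (forall w, differentiable f w) ->
  partial_grad_lipschitz f m L -> strongly_convex mu (gsum g) -> in_domain xs ->
  (forall i, is_argmin (fun u : 'cV[R]_(n i) =>
     ((inner (submxcol (grad f x) i - (submxrow A i)^T *m v) u)%:E + g u
      + (eta / 2 * norm2 (u - submxcol x i) ^+ 2)%:E)%E) (submxcol z i)) ->
  in_domain z /\
  'C(M, m)%:R^-1 * (\sum_(s : {set 'I_M} | #|s| == m)
    let x' := replace_blocks s x z in
    f x' + gval x' - L / 2 * inner (x' - x) (x' - x) + eta * inner (x' - x) (x' - xs)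
    + mu / 2 * (inner (x' - xs) (x' - xs) - inner (x - xs) (x - xs))
    - inner v (A *m (x' - x)))
  <= f x + gval x + m%:R / M%:R * (f xs + gval xs - f x - gval x
     + inner v (A *m (x - xs)) - mu / 2 * inner (x - xs) (x - xs)).
Proof.
move=> mM cf df Lf cg dxs opt.
pose a := grad f x - A^T *m v; pose e2 := inner (x - xs) (x - xs).
have optz : is_argmin (fun u => ((inner a u)%:E + gsum g u
     + (eta / 2 * norm2 (u - x) ^+ 2)%:E)%E) z.
  apply: argmin_blocks => i; rewrite submxcolB -(submxcol_mul _ _ i).
  by rewrite -tr_submxrow; exact: opt.
have [/gsum_fin_num dz prox] := argmin_prox gsum_proper cg optz.
split=> //.
(* Block i of everything that is averaged; only f is not separable, and [partial_descent] replaces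
   it by its linear model. *)
pose w i (u : 'cV[R]_(n i)) : R := inner (submxcol a i) (u - submxcol x i)
  + fine (g u) + eta * inner (u - submxcol x i) (u - submxcol xs i)
  + mu / 2 * inner (u - submxcol xs i) (u - submxcol xs i).
pose W u := \sum_i w i (submxcol u i).
have WE u : W u = inner a (u - x) + gval u + eta * inner (u - x) (u - xs)
    + mu / 2 * inner (u - xs) (u - xs).
  rewrite /W /w !big_split /= -!mulr_sumr /gval !inner_blocks.
  by congr (_ + _ + _ * _ + _ * _); apply: eq_bigr => i _; rewrite !submxcolB.
have aE u : inner a u = inner (grad f x) u - inner v (A *m u).
  by rewrite innerBl inner_trmx.
have step (s : {set 'I_M}) : #|s| = m -> let x' := replace_blocks s x z in
    f x' + gval x' - L / 2 * inner (x' - x) (x' - x) + eta * inner (x' - x) (x' - xs)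
    + mu / 2 * (inner (x' - xs) (x' - xs) - e2) - inner v (A *m (x' - x))
    <= (f x - mu / 2 * e2)
       + \sum_i if i \in s then w i (submxcol z i) else w i (submxcol x i).
  move=> sm /=; set x' := replace_blocks s x z.
  have := partial_descent cf df Lf sm (erefl x'); rewrite -/x' => H.
  have -> : (\sum_i if i \in s then w i (submxcol z i) else w i (submxcol x i)) = W x'.
    by apply: eq_bigr => i _; rewrite submxcol_replace; case: ifP.
  by rewrite WE aE; lra.
apply: le_trans (_ : 'C(M, m)%:R^-1 * (\sum_(s : {set 'I_M} | #|s| == m)
   ((f x - mu / 2 * e2)
    + \sum_i if i \in s then w i (submxcol z i) else w i (submxcol x i))) <= _).
  rewrite ler_wpM2l ?invr_ge0 ?ler0n//; apply: ler_sum => s /eqP sm.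
  exact: step.
rewrite big_split /= mulrDr subset_average_cst ?(andP mM).2//.
rewrite subset_average_sum_if// -/(W z) -/(W x) !WE subrr !inner0r inner0l.
(* Testing optimality of z at xs bounds W z; the differences vanish in W x. *)
have := prox xs (proj2 (gsum_fin_num xs) dxs).
rewrite !gsum_in_domain//= -/e2.
have -> : inner (xs - z) (xs - z) = inner (z - xs) (z - xs).
  by rewrite -opprB innerNl innerNr opprK.
have -> : xs - z = - (z - xs) by rewrite opprB.
rewrite innerNr innerDl innerZl opprK => Hz.
have := convex_grad_ineq xs cf (df x); rewrite mul0r mul0r addr0 => Hf.
have aD : inner a (z - xs) = inner a (z - x) - inner a (xs - x).
  by rewrite -innerBr opprB addrA subrK.
have aX : inner a (xs - x) = inner (grad f x) (xs - x) + inner v (A *m (x - xs)).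
  have e : A *m (xs - x) = - (A *m (x - xs)) by rewrite -mulmxN opprB.
  by rewrite aE e innerNr opprK.
have t0 : 0 <= m%:R / M%:R :> R by rewrite divr_ge0.
set t := m%:R / M%:R in t0 *.
have : t * (inner a (z - x) + gval z + eta * inner (z - x) (z - xs)
    + mu / 2 * inner (z - xs) (z - xs)) <= t * (gval xs + f xs - f x
    + inner v (A *m (x - xs))) by rewrite ler_wpM2l//; lra.
lra.
Qed.

End Objective.
End Blocks.

(** * The one-step estimate for a fixed set of blocks *)

Section WeightedNorms.
Context {R : realType}.

Lemma wnormsqD n (X Y : 'M[R]_n) v : wnormsq (X + Y) v = wnormsq X v + wnormsq Y v.
Proof. by rewrite /wnormsq mulmxDl innerDr. Qed.

Lemma wnormsqZ n (a : R) (X : 'M[R]_n) v : wnormsq (a *: X) v = a * wnormsq X v.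
Proof. by rewrite /wnormsq -scalemxAl innerZr. Qed.

Lemma wnormsqB n (X Y : 'M[R]_n) v : wnormsq (X - Y) v = wnormsq X v - wnormsq Y v.
Proof. by rewrite wnormsqD -scaleN1r wnormsqZ mulN1r. Qed.

Lemma wnormsq_scalar n (a : R) (v : 'cV[R]_n) : wnormsq a%:M v = a * inner v v.
Proof. by rewrite /wnormsq mul_scalar_mx innerZr. Qed.

Lemma wnormsq_gram k n (C : 'M[R]_(k, n)) v :
  wnormsq (C^T *m C) v = inner (C *m v) (C *m v).
Proof. by rewrite /wnormsq -mulmxA -inner_trmx trmxK. Qed.

Lemma psd_mx2_ge (a b d a' b' d' s t : R) :
  psd_ge (2 *: mx2 a b b d) (mx2 a' b' b' d') ->
  a' * s ^+ 2 + 2 * b' * (s * t) + d' * t ^+ 2 <=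
  2 * (a * s ^+ 2 + 2 * b * (s * t) + d * t ^+ 2).
Proof.
move=> [_ /(_ (col_mx s%:M t%:M))]; rewrite wnormsqB wnormsqZ subr_ge0.
suff E a1 b1 d1 : wnormsq (mx2 a1 b1 b1 d1) (col_mx s%:M t%:M) =
    a1 * s ^+ 2 + 2 * b1 * (s * t) + d1 * t ^+ 2 by rewrite !E.
rewrite /wnormsq /mx2 mul_block_col -!scalar_mxM -!raddfD /= /inner tr_col_mx.
by rewrite mul_row_col !tr_scalar_mx -!scalar_mxM -raddfD /= mxE eqxx mulr1n; ring.
Qed.

(** The scalar inequality, summed over the coordinate pairs of u and v. *)
Lemma psd_mx2_inner n (a b d a' b' d' : R) (u v : 'cV[R]_n) :
  psd_ge (2 *: mx2 a b b d) (mx2 a' b' b' d') ->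
  a' * inner u u + 2 * b' * inner u v + d' * inner v v <=
  2 * (a * inner u u + 2 * b * inner u v + d * inner v v).
Proof.
move=> H; rewrite !innerE !mulr_sumr -!big_split /= mulr_sumr.
by apply: ler_sum => i _; have := psd_mx2_ge (u i 0) (v i 0) H; rewrite !expr2.
Qed.

End WeightedNorms.

(** * Growth of the multiplier term *)

Section DualGrowth.
Context {R : realType} {p : nat}.
Variables (theta rho delta kappa : R).
Hypothesis theta01 : 0 < theta <= 1.
Hypothesis delta_gt0 : theta < 1 -> 0 < delta.
Hypothesis delta_kappa :
    psd_ge (2 *: mx2 (1 - (1 - theta) * (1 + delta))
                     ((1 - theta) * (1 + delta))
                     ((1 - theta) * (1 + delta))
                     (kappa - (1 - theta) * (1 + delta)))
           (mx2 theta (1 - theta) (1 - theta) (theta^-1 - (1 - theta))).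

(** The multiplier bracket of [psi] after a step, where L = lam^k - ls and r is the new residual. *)
Definition dual_growth (L r : 'cV[R]_p) : R :=
  inner (L - rho *: r) (L - rho *: r) - (1 - theta) * inner L L
  + theta^-1 * inner (rho *: r) (rho *: r).

(** Origin of the 2x2 condition: with u = L - rho r and v = -rho r, so L = u - v, its smaller matrix
    is the form [dual_growth] in (u, v) and its larger one the bound. *)
Lemma dual_growth_le (L r : 'cV[R]_p) : dual_growth L r <=
  2 * (inner (L - rho *: r) (L - rho *: r) + kappa * inner (rho *: r) (rho *: r)
       - (1 - theta) * (1 + delta) * inner L L).
Proof.
have := psd_mx2_inner (L - rho *: r) (- (rho *: r)) delta_kappa.
rewrite /dual_growth; move: (rho *: r) => w.
rewrite !(innerDl, innerDr, innerNl, innerNr) (innerC w L); lra.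
Qed.

(* When y is not updated, B^T L is not controlled by the optimality condition,
   so L - rho rh is traded for L, which costs the factor 1 + delta. *)
Lemma dual_growth_average (L rt rh : 'cV[R]_p) :
  theta * dual_growth L rt + (1 - theta) * dual_growth L rh <=
  2 * (theta * inner (L - rho *: rt) (L - rho *: rt)
    + kappa * rho ^+ 2 * (theta * inner rt rt + (1 - theta) * inner rh rh)
    + (1 - theta) * (1 + delta^-1) * rho ^+ 2 * inner rh rh).
Proof.
have [t0 t1] := andP theta01.
(* The two outcomes together supply -(1 - theta)(1 + delta) |L|^2, exactly what this bound consumes.
   If theta = 1 both sides vanish, and delta may be 0. *)
have H : (1 - theta) * inner (L - rho *: rh) (L - rho *: rh) <=
    (1 - theta) * ((1 + delta) * inner L L + (1 + delta^-1) * rho ^+ 2 * inner rh rh).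
  move: t1; rewrite le_eqVlt => /orP[/eqP ->|t1]; first by rewrite subrr !mul0r.
  rewrite ler_pM2l ?subr_gt0//.
  have := young L (- (rho *: rh)) (delta_gt0 t1).
  rewrite !(innerDl, innerDr, innerNl, innerNr, innerZl, innerZr) (innerC rh L); lra.
have Ht := ler_wpM2l (ltW t0) (dual_growth_le L rt).
have t1' : 0 <= 1 - theta by rewrite subr_ge0.
have Hh := ler_wpM2l t1' (dual_growth_le L rh).
apply: le_trans (lerD Ht Hh) _.
rewrite !(innerZl rho rt, innerZr rho rt, innerZl rho rh, innerZr rho rh).
move: (inner (L - rho *: rt) (L - rho *: rt)) (inner (L - rho *: rh) (L - rho *: rh)) H.
by move=> X Y H; lra.
Qed.

End DualGrowth.

(** * The quadratic estimate averaged over the coin *)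

Section CoinStep.
Context {R : realType} {N p q : nat}.
Variables (A : 'M[R]_(p, N)) (B : 'M[R]_(p, q)).
Variables (theta mu nu Lm Lh alpha gamma : R).
Variables (beta rho etax etay c tau1 tau2 delta kappa sigma eta : R).
Let P := etax%:M - beta *: (A^T *m A).
Let Q := etay%:M - beta *: (B^T *m B).

(** The real integrand of [psi]: D and G are the objective and gradient parts of Psi, [drift] is the
    multiplier bracket. *)
Definition lyapunov (D G : R) (e : 'cV[R]_N) (u : 'cV[R]_q) (r : 'cV[R]_p)
    (drift : R) : R :=
  (1 - theta) * (D + G) + beta * (1 - theta) / 2 * inner r r
  + 2^-1 * wnormsq (P + (mu * (1 - theta))%:M) e
  + 2^-1 * wnormsq (Q + (beta * (1 - theta) / tau2) *: (B^T *m B)) u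
  + (2 * rho)^-1 * drift.

Hypothesis theta01 : 0 < theta <= 1.
Hypothesis alpha01 : 0 < alpha < theta.
Hypothesis (mu_gt0 : 0 < mu) (nu_gt0 : 0 < nu) (gamma_gt0 : 0 < gamma).
Hypothesis rhoE : rho = theta * beta.
Hypothesis (beta_gt0 : 0 < beta) (c_gt0 : 0 < c).
Hypothesis (tau1_gt0 : 0 < tau1) (tau2_gt0 : 0 < tau2).
Hypothesis delta_ge0 : 0 <= delta.
Hypothesis delta_gt0 : theta < 1 -> 0 < delta.
Hypothesis kappa_ge0 : 0 <= kappa.
Hypothesis gammaA : 8 * spectral_norm A ^+ 2 / (alpha * mu) <= gamma.
Hypothesis gammaB : 8 * spectral_norm B ^+ 2 / (alpha * nu) <= gamma.
Hypothesis (A_le1 : spectral_norm A <= 1) (B_le1 : spectral_norm B <= 1).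
Hypothesis delta_kappa :
    psd_ge (2 *: mx2 (1 - (1 - theta) * (1 + delta))
                     ((1 - theta) * (1 + delta))
                     ((1 - theta) * (1 + delta))
                     (kappa - (1 - theta) * (1 + delta)))
           (mx2 theta (1 - theta) (1 - theta) (theta^-1 - (1 - theta))).
Hypothesis P_ge : psd_ge P ((beta * (1 - theta) * tau2) *: (A^T *m A) + Lm%:M).
Hypothesis Q_ge : psd_ge Q
    ((8 * c) *: (Q^T *m Q)
     + (4 * c * rho ^+ 2 * ((1 - theta) * (1 + delta^-1))) *:
         (B^T *m B *m B^T *m B)
     + (beta * tau1) *: (B^T *m B)).
Hypothesis sigma_ge0 : 0 <= sigma.
Hypothesis sigma_le1 : sigma <= 1.
Hypothesis sigma_le : forall v, sigma * inner v v <= inner (B^T *m v) (B^T *m v).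
Hypothesis eta_ge1 : 1 <= eta.
Hypothesis eta_Psi : eta * (1 - theta) <= 1 - alpha.
Hypothesis eta_x : (eta - 1) * (etax + mu * (1 - theta)) <=
  alpha / 2 * mu + theta * mu - beta / tau1.
Hypothesis eta_y : (eta - 1) * (etay / 2 + beta * (1 - theta) / (2 * tau2)) <=
  3 * alpha * nu / 4 - 4 * c * Lh ^+ 2 - beta * (1 - theta) / (2 * tau2).
Hypothesis eta_r : (eta - 1) * (beta * (1 - theta)) <=
  2 / gamma - 2 * c * rho ^+ 2 * (kappa + 2 * ((1 - theta) * (1 + delta^-1)))
  - 4 * c * (beta - rho) ^+ 2.
Hypothesis eta_lam : eta - 1 <= c * rho * sigma.

Let wP v : wnormsq P v = etax * inner v v - beta * inner (A *m v) (A *m v).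
Proof. by rewrite wnormsqB wnormsqZ wnormsq_scalar wnormsq_gram. Qed.

Let wQ v : wnormsq Q v = etay * inner v v - beta * inner (B *m v) (B *m v).
Proof. by rewrite wnormsqB wnormsqZ wnormsq_scalar wnormsq_gram. Qed.

Let P_geE v : beta * (1 - theta) * tau2 * inner (A *m v) (A *m v) + Lm * inner v v
  <= etax * inner v v - beta * inner (A *m v) (A *m v).
Proof.
have [_ /(_ v)] := P_ge.
by rewrite wnormsqB wP wnormsqD wnormsqZ wnormsq_gram wnormsq_scalar subr_ge0.
Qed.

Let kappa1 := (1 - theta) * (1 + delta^-1).

Let kappa1_ge0 : 0 <= kappa1.
Proof.
by rewrite mulr_ge0 ?subr_ge0 ?addr_ge0 ?invr_ge0//; case/andP: theta01.
Qed.

Let Q_geE v : 8 * c * inner (Q *m v) (Q *m v)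
  + 4 * c * rho ^+ 2 * kappa1 * inner (B^T *m (B *m v)) (B^T *m (B *m v))
  + beta * tau1 * inner (B *m v) (B *m v)
  <= etay * inner v v - beta * inner (B *m v) (B *m v).
Proof.
have [_ /(_ v)] := Q_ge.
rewrite wnormsqB wQ !wnormsqD !wnormsqZ !wnormsq_gram subr_ge0.
have -> : B^T *m B *m B^T *m B = (B^T *m B)^T *m (B^T *m B).
  by rewrite trmx_mul trmxK !mulmxA.
by rewrite wnormsq_gram -mulmxA.
Qed.

Let A_le v : inner (A *m v) (A *m v) <= inner v v.
Proof. exact: inner_mulmx_le1. Qed.

Let B_le v : inner (B *m v) (B *m v) <= inner v v.
Proof. exact: inner_mulmx_le1. Qed.

(** The 8 in gamma is 2 * 4: 2 from splitting the square, 4 from the quarters on the right. *)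
Let residual_le e u : gamma^-1 * inner (A *m e + B *m u) (A *m e + B *m u) <=
  alpha * mu / 4 * inner e e + alpha * nu / 4 * inner u u.
Proof.
have [a0 _] := andP alpha01.
have am : 0 < alpha * mu by rewrite mulr_gt0.
have an : 0 < alpha * nu by rewrite mulr_gt0.
rewrite ler_pdivrMl//; apply: le_trans (inner_sqrD _ _) _.
have := inner_mulmx_le A e; have := inner_mulmx_le B u.
move: gammaA gammaB; rewrite !ler_pdivrMr//.
move: (spectral_norm A ^+ 2) (spectral_norm B ^+ 2) => a b Ha Hb.
have := ler_wpM2r (inner_ge0 e) Ha; have := ler_wpM2r (inner_ge0 u) Hb; lra.
Qed.

Let eta_m1 : 0 <= eta - 1.
Proof. by rewrite subr_ge0. Qed.

(** The first four entries of eta pay for the growth of D + G, e, u and r in turn; the drift keeps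
    its factor eta. *)
Lemma lyapunov_growth D G e u r drift :
  mu / 2 * inner e e <= D -> nu * inner u u <= G ->
  eta * lyapunov D G e u r drift <=
  (1 - alpha) * (D + G) + beta * (1 - theta) / 2 * inner r r
  + (gamma^-1 - c * rho ^+ 2 * (kappa + 2 * kappa1) - 2 * c * (beta - rho) ^+ 2)
    * inner r r
  + 2^-1 * (etax * inner e e - beta * inner (A *m e) (A *m e)
            + mu * (1 - theta) * inner e e)
  + (alpha / 4 * mu + theta / 2 * mu - beta / (2 * tau1)) * inner e e
  + 2^-1 * (etay * inner u u - beta * inner (B *m u) (B *m u))
  + (3 * alpha * nu / 4 - 4 * c * Lh ^+ 2) * inner u u
  + eta * ((2 * rho)^-1 * drift).
Proof.
move=> De Gu.
have e0 := inner_ge0 e; have u0 := inner_ge0 u; have r0 := inner_ge0 r.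
have DG : 0 <= D + G.
  by rewrite addr_ge0// (le_trans _ De, le_trans _ Gu)// mulr_ge0// ltW// divr_gt0.
have [t0 t1] := andP theta01; have t1' : 0 <= 1 - theta by rewrite subr_ge0.
have Ae := inner_ge0 (A *m e); have Bu0 := inner_ge0 (B *m u); have Bu := B_le u.
rewrite /lyapunov (wnormsqD P) wP (wnormsqD Q) wQ wnormsq_scalar wnormsqZ wnormsq_gram.
have h1 := ler_wpM2r DG eta_Psi.
have h2 := ler_wpM2r e0 eta_x.
have h3 := ler_wpM2r u0 eta_y.
have h4 := ler_wpM2r r0 eta_r; rewrite -/kappa1 in h4.
(* The negative parts of P and Q only decrease further when multiplied by eta. *)
have h5 : 0 <= (eta - 1) * (beta * inner (A *m e) (A *m e)).
  by rewrite !mulr_ge0// ltW.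
have h6 : 0 <= (eta - 1) * (beta * inner (B *m u) (B *m u)).
  by rewrite !mulr_ge0// ltW.
(* The whole tau2 term is bounded, not just its growth; hence beta (1 - theta)/(2 tau2) occurs in
   both numerator and denominator of the third quotient. *)
have h7 : eta * (beta * (1 - theta) / (2 * tau2) * inner (B *m u) (B *m u)) <=
   eta * (beta * (1 - theta) / (2 * tau2) * inner u u).
  rewrite ler_wpM2l ?(le_trans _ eta_ge1)// ler_wpM2l// mulr_ge0 ?invr_ge0 ?mulr_ge0//;
    exact: ltW.
move: h1 h2 h3 h4 h5 h6 h7; rewrite !invfM.
lra.
Qed.

(** Replacing r^(k+1/2) by r^(k+1) costs beta B^T B dy, which combines with etay dy to Q dy; by
    optimality, the other two terms of the bracket are the new gradient difference. *)
Lemma optimality_dual (L rh : 'cV[R]_p) (dy : 'cV[R]_q) :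
  B^T *m (L - rho *: (rh + B *m dy)) = (beta - rho) *: (B^T *m (rh + B *m dy))
    + (B^T *m (L - beta *: rh) - etay *: dy + Q *m dy).
Proof.
rewrite /Q mulmxBl mul_scalar_mx -scalemxAl -mulmxA.
rewrite !(mulmxBr, mulmxDr) -!scalemxAr !mulmxDr.
by apply/colP => i; rewrite !mxE; ring.
Qed.

Lemma dual_drift_le (L rh : 'cV[R]_p) (u ut gt : 'cV[R]_q) :
  let rt := rh + B *m (ut - u) in
  gt = B^T *m (L - beta *: rh) - etay *: (ut - u) ->
  inner gt gt <= Lh ^+ 2 * inner ut ut ->
  (eta - 1) * ((2 * rho)^-1 * (theta * dual_growth theta rho L rt
     + (1 - theta) * dual_growth theta rho L rh)) <=
  c * (theta * (4 * Lh ^+ 2 * inner ut ut + 2 * (beta - rho) ^+ 2 * inner rt rt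
         + 4 * inner (Q *m (ut - u)) (Q *m (ut - u)))
    + rho ^+ 2 * kappa * (theta * inner rt rt + (1 - theta) * inner rh rh)
    + kappa1 * rho ^+ 2 * (2 * (theta * inner rt rt + (1 - theta) * inner rh rh)
        + 2 * theta * inner (B^T *m (B *m (ut - u))) (B^T *m (B *m (ut - u))))).
Proof.
move=> rt gtE gt_le; set dy := ut - u in rt gtE *; set W := c * _.
have [t0 t1] := andP theta01; have t1' : 0 <= 1 - theta by rewrite subr_ge0.
have rho0 : 0 < rho by rewrite rhoE mulr_gt0.
set V := _ + _ * dual_growth _ _ _ rh.
have Rt0 := inner_ge0 rt; have Rh0 := inner_ge0 rh.
have Wge0 : 0 <= W.
  have S0 : 0 <= theta * inner rt rt + (1 - theta) * inner rh rh.
    by rewrite addr_ge0// mulr_ge0// ltW.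
  have B0 := inner_ge0 (B^T *m (B *m dy)); have Q0 := inner_ge0 (Q *m dy).
  have u0 := inner_ge0 ut; have l0 := sqr_ge0 Lh; have r0 := sqr_ge0 rho.
  have b0 := sqr_ge0 (beta - rho); have t0' := ltW t0.
  apply: mulr_ge0; first exact: ltW.
  by repeat first [done | apply: addr_ge0 | apply: mulr_ge0].
suff HV : c * sigma / 2 * V <= W.
  (* V may be negative; then the left side is at most 0 and W >= 0 suffices. *)
  have [V0|/ltW V0] := leP 0 V.
    apply: le_trans HV; rewrite mulrA ler_wpM2r// ler_pdivrMr ?mulr_gt0//.
    by apply: le_trans eta_lam _; rewrite le_eqVlt; apply/orP; left; apply/eqP; field.
  apply: le_trans Wge0; apply: mulr_ge0_le0 => //; apply: mulr_ge0_le0 => //.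
  by rewrite invr_ge0 mulr_ge0// ltW.
set Lt := L - rho *: rt.
have BLt : B^T *m Lt = (beta - rho) *: (B^T *m rt) + (gt + Q *m dy).
  by rewrite gtE; exact: optimality_dual.
have s1 : sigma * inner Lt Lt <= 2 * (beta - rho) ^+ 2 * inner rt rt
    + 4 * Lh ^+ 2 * inner ut ut + 4 * inner (Q *m dy) (Q *m dy).
  apply: le_trans (sigma_le Lt) _; rewrite BLt.
  apply: le_trans (inner_sqrD _ _) _; rewrite innerZl innerZr.
  have := inner_sqrD gt (Q *m dy).
  have := inner_trmx_mulmx_le1 rt B_le1 => /(ler_wpM2l (sqr_ge0 (beta - rho))).
  lra.
(* The residual rh is charged to both outcomes: a share theta goes through rh = rt - B dy, with
   sigma spent on B dy, and a share 1 - theta stays. *)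
have s2 : sigma * inner rh rh <= 2 * (theta * inner rt rt + (1 - theta) * inner rh rh)
    + 2 * theta * inner (B^T *m (B *m dy)) (B^T *m (B *m dy)).
  have H1 : inner rh rh <= 2 * inner rt rt + 2 * inner (B *m dy) (B *m dy).
    have := inner_sqrD rt (- (B *m dy)).
    by rewrite {1 2}/rt addrK innerNl innerNr opprK.
  have H2 := sigma_le (B *m dy).
  have H3 := ler_wpM2l sigma_ge0 H1.
  have H4 : sigma * inner rt rt <= inner rt rt by rewrite -[leRHS]mul1r ler_wpM2r.
  have H5 : sigma * inner rh rh <= inner rh rh by rewrite -[leRHS]mul1r ler_wpM2r.
  have H6 : theta * (sigma * inner rh rh) <= theta * (2 * inner rt rt +
      2 * inner (B^T *m (B *m dy)) (B^T *m (B *m dy))).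
    by rewrite ler_pM2l//; lra.
  have H7 : (1 - theta) * (sigma * inner rh rh) <= (1 - theta) * (2 * inner rh rh).
    by rewrite ler_wpM2l//; lra.
  lra.
have HV := dual_growth_average rho theta01 delta_gt0 delta_kappa L rt rh.
rewrite -/V -/Lt -/kappa1 in HV.
have S0 : 0 <= theta * inner rt rt + (1 - theta) * inner rh rh.
  by rewrite addr_ge0// mulr_ge0// ltW.
set S := theta * inner rt rt + _ in HV S0 s2 W Wge0 *.
have H8 : kappa * rho ^+ 2 * (sigma * S) <= kappa * rho ^+ 2 * S.
  apply: ler_wpM2l; first by rewrite mulr_ge0 ?sqr_ge0.
  by rewrite -[leRHS]mul1r; exact: ler_wpM2r.
have H9 : kappa1 * rho ^+ 2 * (sigma * inner rh rh) <= kappa1 * rho ^+ 2 * (2 * S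
    + 2 * theta * inner (B^T *m (B *m dy)) (B^T *m (B *m dy))).
  by apply: ler_wpM2l => //; exact: (mulr_ge0 kappa1_ge0 (sqr_ge0 rho)).
have H10 := ler_wpM2l (ltW t0) s1.
have H11 := ler_wpM2l sigma_ge0 HV.
rewrite -!mulrA /W; apply: ler_wpM2l; first exact: ltW.
by move: kappa1 H9 H11 => k1 H9 H11; lra.
Qed.

(** The coefficient of |L|^2 is the same as in [dual_driftE], so this term cancels between
    consecutive steps. *)
Lemma dual_growthE (L r : 'cV[R]_p) : (2 * rho)^-1 * dual_growth theta rho L r =
  (2 * beta)^-1 * inner L L - inner L r + beta * (1 + theta) / 2 * inner r r.
Proof.
have [t0 _] := andP theta01.
rewrite /dual_growth !(innerDl, innerDr, innerNl, innerNr, innerZl, innerZr).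
by rewrite (innerC r L) rhoE; field; rewrite !gt_eqF.
Qed.

Lemma dual_driftE (L r : 'cV[R]_p) : (2 * rho)^-1 *
    (inner L L - (1 - theta) * inner (L + rho *: r) (L + rho *: r)
     + theta^-1 * inner (rho *: r) (rho *: r)) =
  (2 * beta)^-1 * inner L L - (1 - theta) * inner L r
  + beta * (1 - theta * (1 - theta)) / 2 * inner r r.
Proof.
have [t0 _] := andP theta01.
rewrite !(innerDl, innerDr, innerZl, innerZr).
by rewrite (innerC r L) rhoE; field; rewrite !gt_eqF.
Qed.

(** Primes mark the step just taken in x, ut and Gt the updated y. The equation for D' merely
    defines Z, which is later averaged over draws. *)
Lemma coin_step (D D' G Gt Z : R) (e e' : 'cV[R]_N) (u ut gt : 'cV[R]_q)
    (L r rh rt : 'cV[R]_p) :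
  r = A *m e + B *m u -> rh = A *m e' + B *m u -> rt = A *m e' + B *m ut ->
  mu / 2 * inner e' e' <= D' -> nu * inner u u <= G -> nu * inner ut ut <= Gt ->
  Gt = inner ut gt -> inner gt gt <= Lh ^+ 2 * inner ut ut ->
  gt = B^T *m (L - beta *: rh) - etay *: (ut - u) ->
  D' = Z + (1 - theta) * D + (1 - theta) * mu / 2 * inner e e
    - mu / 2 * inner e' e' + Lm / 2 * inner (e' - e) (e' - e)
    - etax * inner (e' - e) e' + inner (L - beta *: r) (A *m e')
    - (1 - theta) * inner (L - beta *: r) (A *m e) ->
  eta * (theta * lyapunov D' Gt e' ut rt (dual_growth theta rho L rt)
         + (1 - theta) * lyapunov D' G e' u rh (dual_growth theta rho L rh)) <=
  lyapunov D G e u r (inner L L - (1 - theta) * inner (L + rho *: r) (L + rho *: r)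
     + theta^-1 * inner (rho *: r) (rho *: r)) + Z.
Proof.
move=> rE rhE rtE De' Gu Gut GtE gt_le gtE D'E.
have [t0 t1] := andP theta01; have t1' : 0 <= 1 - theta by rewrite subr_ge0.
have rtE' : rt = rh + B *m (ut - u).
  by rewrite rtE rhE mulmxBr; apply/colP => i; rewrite !mxE; ring.
have drift := dual_drift_le gtE gt_le; rewrite /= -rtE' in drift.
have h1 := ler_wpM2l (ltW t0) (lyapunov_growth rt (dual_growth theta rho L rt) De' Gut).
have h2 := ler_wpM2l t1' (lyapunov_growth rh (dual_growth theta rho L rh) De' Gu).
have r1 := ler_wpM2l (ltW t0) (residual_le e' ut); rewrite -rtE in r1.
have r2 := ler_wpM2l t1' (residual_le e' u); rewrite -rhE in r2.
have p1 := P_geE (e' - e).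
have q1 := ler_wpM2l (ltW t0) (Q_geE (ut - u)).
(* The only cross terms left after the expansion: y1 is paid by Q and mu, y2 by P and the B^T B
   weight of [lyapunov] at step k. *)
have y1 := ler_wpM2l (mulr_ge0 (ltW t0) (ltW beta_gt0))
  (young (B *m (ut - u)) (A *m e') tau1_gt0).
have y2 := ler_wpM2l (mulr_ge0 t1' (ltW beta_gt0))
  (young (A *m (e' - e)) (B *m u) tau2_gt0).
have al0 : 0 <= alpha by case/andP: alpha01 => /ltW.
(* The fraction alpha yields alpha mu/2 and alpha nu: a quarter of alpha mu and of alpha nu goes to
   [residual_le], the rest to growth. *)
have f1 := ler_wpM2l al0 De'.
have f2 := ler_wpM2l (mulr_ge0 (ltW t0) al0) Gut.
have f3 := ler_wpM2l (mulr_ge0 t1' al0) Gu.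
have i1 : 0 <= tau1^-1 by rewrite invr_ge0 ltW.
have a1 := ler_wpM2l (mulr_ge0 (ltW t0) (mulr_ge0 (ltW beta_gt0) i1)) (A_le e').
(* [lyapunov_growth] reserves the same amounts whether or not y moves; n1 to n3 discard what a
   failed coin leaves over, n4 the surplus in |r|^2. *)
have n1 : 0 <= (1 - theta) * (beta * tau1^-1 * inner e' e').
  by rewrite !mulr_ge0 ?inner_ge0// ltW.
have n2 : 0 <= (1 - theta) * (c * (Lh ^+ 2 * inner u u)).
  by repeat first
    [done | exact: inner_ge0 | exact: sqr_ge0 | exact: ltW | apply: mulr_ge0].
have n3 : 0 <= (1 - theta) * (c * ((beta - rho) ^+ 2 * inner rh rh)).
  by repeat first
    [done | exact: inner_ge0 | exact: sqr_ge0 | exact: ltW | apply: mulr_ge0].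
have n4 : 0 <= beta * theta ^+ 2 * inner r r.
  by repeat first
    [done | exact: inner_ge0 | exact: sqr_ge0 | exact: ltW | apply: mulr_ge0].
move: (lyapunov D' Gt e' ut rt _) (lyapunov D' G e' u rh _) h1 h2 => X1 X2 h1 h2.
rewrite /lyapunov (wnormsqD P) wP (wnormsqD Q) wQ wnormsq_scalar wnormsqZ wnormsq_gram.
rewrite dual_driftE; move: drift; rewrite mulrDr !(mulrCA (2 * rho)^-1).
move: h1 h2; rewrite !dual_growthE => h1 h2 drift.
have GtE' : Gt = inner (L - beta *: rh) (B *m ut) - etay * inner ut (ut - u).
  by rewrite GtE gtE (innerBr (B^T *m _)) innerZr innerC inner_trmx.
move: h1 h2 drift r1 r2 p1 q1 y1 y2 a1 f1 f2 f3 n1 n2 n3 n4.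
rewrite D'E GtE' !invfM.
move: (inner (Q *m (ut - u)) (Q *m (ut - u))) => q2.
move: (inner (B^T *m (B *m (ut - u))) (B^T *m (B *m (ut - u)))) => q4.
rewrite rtE rhE rE !mulmxBr.
move: (A *m e) (A *m e') (B *m u) (B *m ut) => a a' b b'.
rewrite !(innerDl, innerDr, innerNl, innerNr, innerZl, innerZr).
rewrite ?(innerC a' a) ?(innerC b a) ?(innerC b' a) ?(innerC b a') ?(innerC b' a')
  ?(innerC b' b) ?(innerC a L) ?(innerC a' L) ?(innerC b L) ?(innerC b' L)
  ?(innerC e' e) ?(innerC ut u).
move=> h1 h2 drift r1 r2 p1 q1 y1 y2 a1 f1 f2 f3 n1 n2 n3 n4.
lra.
Qed.

End CoinStep.

(** * The history of random choices *)

Section FiniteValued.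
Context {R : realType} d {T : measurableType d} (Pr : probability T R).
Context {F : finType} (X : T -> F).
Hypothesis mX : forall a, measurable (X @^-1` [set a]).

Definition prob_of (a : F) : R := fine (Pr (X @^-1` [set a])).

Lemma prob_ofE a : (prob_of a)%:E = Pr (X @^-1` [set a]).
Proof. by rewrite /prob_of fineK// fin_num_measure. Qed.

Lemma prob_of_ge0 a : 0 <= prob_of a.
Proof. by rewrite -lee_fin prob_ofE measure_ge0. Qed.

Lemma prob_of_gt0_ex a : prob_of a != 0 -> exists w, X w = a.
Proof.
move=> pa; apply/not_existsP => H; move/eqP: pa; apply.
rewrite /prob_of (_ : X @^-1` [set a] = set0) ?measure0//.
by apply/seteqP; split=> // w /= Xw; exact: (H w).
Qed.

Let indicE w a : \1_(X @^-1` [set a]) w = (X w == a)%:R :> R.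
Proof.
rewrite indicE; congr (_%:R); congr nat_of_bool.
by apply/idP/eqP => [|Xw]; [rewrite inE|rewrite inE].
Qed.

(** Only the fibres of X need be measurable, so measurability of the iterates is never an issue. *)
Lemma integral_finite_valued (phi : F -> R) :
  (\int[Pr]_w (phi (X w))%:E)%E = (\sum_a prob_of a * phi a)%:E.
Proof.
rewrite (eq_integral (fun w => \sum_a ((phi a)%:E * (\1_(X @^-1` [set a]) w)%:E)))%E;
    last first.
  move=> w _; rewrite (bigD1 (X w))//= big1 ?adde0 ?indicE ?eqxx ?mule1// => a /negPf aX.
  by rewrite indicE eq_sym aX mule0.
rewrite integral_sum//; last first.
  by move=> a; apply: integrableZl => //; exact: integrable_indic.
rewrite -sumEFin; apply: eq_bigr => a _.
rewrite integralZl//; last exact: integrable_indic.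
by rewrite integral_indic// setIT mulrC EFinM; congr (_ * _)%E; rewrite prob_ofE.
Qed.

Lemma integral_finite_valued_pinfty (phi : F -> \bar R) a : (forall b, 0 <= phi b)%E ->
  phi a = +oo%E -> prob_of a != 0 -> (\int[Pr]_w phi (X w))%E = +oo%E.
Proof.
move=> phi0 phia pa.
rewrite (eq_integral (fun w => \sum_a (phi a * (\1_(X @^-1` [set a]) w)%:E)))%E;
    last first.
  move=> w _; rewrite (bigD1 (X w))//= big1 ?adde0 ?indicE ?eqxx ?mule1// => b /negPf bX.
  by rewrite indicE eq_sym bX mule0.
have mind b := measurable_int Pr (integrable_indic Pr (mX b)).
rewrite ge0_integral_sum//; last 2 first.
- by move=> b; apply: emeasurable_funM => //; exact: measurable_cst.
- by move=> b w _; rewrite mule_ge0.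
apply/eqP; rewrite esum_eqy => [|b _]; last first.
  by rewrite gt_eqF// (lt_le_trans (ltNy0))// integral_ge0// => w _; rewrite mule_ge0.
apply/existsP; exists a; rewrite /= ge0_integralZl//.
rewrite integral_indic// setIT phia; apply/eqP/gt0_mulye.
by rewrite -[X in (_ < X)%E]prob_ofE lte_fin lt_def pa prob_of_ge0.
Qed.

End FiniteValued.

Section History.
Context {R : realType} {M : nat} d {T : measurableType d} (Pr : probability T R).
Variables (m : nat) (theta : R) (S : nat -> T -> {set 'I_M}) (Y : nat -> T -> bool).
Hypothesis HS : sampling Pr m theta S Y.

Local Notation choice_type := ({set 'I_M} * bool)%type.

(** Position i holds the choices of iteration i+1, so the state at K+1 depends on [history K]. *)
Definition history (K : nat) (w : T) : K.-tuple choice_type :=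
  [tuple (S i.+1 w, Y i.+1 w) | i < K].

(** A pair rather than a longer tuple, so that its law visibly factors into past and new choice. *)
Definition history_step (K : nat) (w : T) : K.-tuple choice_type * choice_type :=
  (history K w, (S K.+1 w, Y K.+1 w)).

Definition choices_event (K : nat) (c : nat -> choice_type) : set T :=
  \bigcap_(k in [set k | (1 <= k <= K)%N])
     (S k @^-1` [set (c k).1] `&` Y k @^-1` [set (c k).2]).

Lemma choices_event_measurable K c : measurable (choices_event K c).
Proof.
apply: fin_bigcap_measurable => [|k /= /andP[k1 _]].
  apply: (sub_finite_set _ (finite_II K.+1)) => k /= /andP[_ kK].
  by rewrite ltnS.
apply: measurableI; first exact: (sampling_measurable_S HS).
exact: (sampling_measurable_Y HS).
Qed.

Lemma choices_eventE K c w : choices_event K c w <->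
  forall k, (1 <= k <= K)%N -> S k w = (c k).1 /\ Y k w = (c k).2.
Proof. by []. Qed.

Lemma nth_history K w k : (k < K)%N ->
  nth (finset.set0, false) (history K w) k = (S k.+1 w, Y k.+1 w).
Proof.
by move=> kK; rewrite -[k in LHS]/(nat_of_ord (Ordinal kK)) -tnth_nth tnth_mktuple.
Qed.

Lemma history_event K (t : K.-tuple choice_type) :
  history K @^-1` [set t] = choices_event K (fun k => nth (finset.set0, false) t k.-1).
Proof.
apply/seteqP; split=> w.
  by move=> /= <- [//|k] /= kK; rewrite nth_history.
move=> /choices_eventE H; apply/eq_from_tnth => i; rewrite tnth_mktuple.
have [] := H i.+1 (ltn_ord i); rewrite /= -tnth_nth => -> ->.
by case: (tnth t i).
Qed.

Lemma history_step_event K (t : K.-tuple choice_type) c :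
  history_step K @^-1` [set (t, c)] = choices_event K.+1
    (fun k => if k == K.+1 then c else nth (finset.set0, false) t k.-1).
Proof.
have HE := history_event t; apply/seteqP; split=> w.
  move=> [ht hc] k /= /andP[k1]; rewrite leq_eqVlt => /orP[/eqP ->|kK].
    by rewrite eqxx -hc.
  rewrite ltn_eqF//.
  have : (history K @^-1` [set t]) w by [].
  by rewrite HE => /(_ k); apply; rewrite /= k1.
move=> /choices_eventE H; rewrite /history_step /=.
have [] := H K.+1; first by rewrite /= leqnn.
rewrite eqxx => -> ->; congr (_, _); last by case: c H.
suff : (history K @^-1` [set t]) w by [].
rewrite HE => k /= /andP[k1 kK].
by have := H k; rewrite k1 (leqW kK) ltn_eqF//; apply.
Qed.

Lemma history_measurable K t : measurable (history K @^-1` [set t]).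
Proof. by rewrite history_event; exact: choices_event_measurable. Qed.

Lemma history_step_measurable K t : measurable (history_step K @^-1` [set t]).
Proof. by case: t => t c; rewrite history_step_event; exact: choices_event_measurable. Qed.

Lemma choices_event_prob K c : Pr (choices_event K c) = (\big[*%E/1]_(1 <= k < K.+1)
   (Pr (S k @^-1` [set (c k).1]) * Pr (Y k @^-1` [set (c k).2])))%E.
Proof.
exact: (sampling_independent HS K (fun k => [set (c k).1]) (fun k => [set (c k).2])).
Qed.

Lemma history_step_prob K t c : prob_of Pr (history_step K) (t, c) =
  prob_of Pr (history K) t * (prob_of Pr (S K.+1) c.1 * prob_of Pr (Y K.+1) c.2).
Proof.
apply: EFin_inj; rewrite !EFinM !prob_ofE; first last.
- exact: history_step_measurable.
- exact: history_measurable.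
- by move=> s; exact: (sampling_measurable_S HS).
- by move=> s; exact: (sampling_measurable_Y HS).
rewrite history_step_event history_event !choices_event_prob big_nat_recr//= eqxx.
congr (_ * _)%E; apply: eq_big_nat => k /andP[k1 kK].
by rewrite ltn_eqF.
Qed.

Lemma prob_of_set k s : (1 <= k)%N ->
  prob_of Pr (S k) s = if #|s| == m then 'C(M, m)%:R^-1 else 0.
Proof.
move=> k1; rewrite /prob_of; case: eqP => sm.
  by rewrite (sampling_uniform HS k1 sm).
rewrite (_ : S k @^-1` [set s] = set0) ?measure0//.
by apply/seteqP; split=> // w /= Sw; apply: sm; rewrite -Sw (sampling_card HS).
Qed.

Lemma prob_of_coin k b : (1 <= k)%N ->
  prob_of Pr (Y k) b = if b then theta else 1 - theta.
Proof.
move=> k1; rewrite /prob_of; case: b; first by rewrite (sampling_coin HS k1).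
have -> : Y k @^-1` [set false] = ~` (Y k @^-1` [set true]).
  by apply/seteqP; split=> w /=; case: (Y k w).
rewrite probability_setC ?(sampling_coin HS k1)//.
exact: (sampling_measurable_Y HS).
Qed.

(** Hence a single outcome with infinite Psi already makes the expectation infinite. *)
Lemma history_prob_neq0 K w : (0 < m <= M)%N -> 0 < theta < 1 ->
  prob_of Pr (history K) (history K w) != 0.
Proof.
move=> /andP[m0 mM] /andP[t0 t1]; rewrite gt_eqF// -lte_fin prob_ofE; last first.
  exact: history_measurable.
rewrite history_event choices_event_prob big_seq_cond.
apply: (big_ind (fun v => (0 < v)%E)) => // [a c|k]; first exact: mule_gt0.
rewrite mem_index_iota andbT => /andP[k1 kK].
case: k k1 kK => // k _ kK; rewrite [k.+1.-1]/= nth_history//=.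
rewrite mule_gt0// -prob_ofE ?lte_fin.
- by rewrite prob_of_set// (sampling_card HS)// eqxx invr_gt0 ltr0n bin_gt0.
- by move=> a; exact: (sampling_measurable_S HS).
- by rewrite prob_of_coin//; case: ifP; rewrite ?subr_gt0.
- by move=> a; exact: (sampling_measurable_Y HS).
Qed.

(** Conditioning on the past, in finite form. *)
Lemma history_step_sum K (V : K.-tuple choice_type * choice_type -> R) :
  \sum_a prob_of Pr (history_step K) a * V a =
  \sum_t prob_of Pr (history K) t * ('C(M, m)%:R^-1 * \sum_(s : {set 'I_M} | #|s| == m)
     (theta * V (t, (s, true)) + (1 - theta) * V (t, (s, false)))).
Proof.
rewrite (eq_bigr (fun a => prob_of Pr (history_step K) (a.1, a.2) * V (a.1, a.2)))
  => [|[]//].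
rewrite -(pair_bigA _ (fun t c => prob_of Pr (history_step K) (t, c) * V (t, c))) /=.
apply: eq_bigr => t _.
rewrite (eq_bigr (fun c => prob_of Pr (history_step K) (t, (c.1, c.2)) * V (t, (c.1, c.2))))
  => [|[]//].
rewrite -(pair_bigA _ (fun s b => prob_of Pr (history_step K) (t, (s, b)) * V (t, (s, b)))) /=.
rewrite !mulr_sumr [RHS]big_mkcond; apply: eq_bigr => s _.
rewrite big_bool !history_step_prob /= !prob_of_set// !prob_of_coin//.
by case: ifP => _; ring.
Qed.

End History.

(** * The iterates as functions of the history *)

Section Iteration.
Context {R : realType} {M : nat} {n : 'I_M -> nat} {p q : nat}.
Context d {T : measurableType d}.
Local Notation N := (\sum_i n i)%N.
Variables (A : 'M[R]_(p, N)) (B : 'M[R]_(p, q)) (b : 'cV[R]_p).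
Variables (f : 'cV[R]_N -> R) (g : forall i, 'cV[R]_(n i) -> \bar R).
Variable (h : 'cV[R]_q -> R).
Variables (beta rho etax etay nu : R) (x1 : 'cV[R]_N) (y1 : 'cV[R]_q).
Variables (S : nat -> T -> {set 'I_M}) (Y : nat -> T -> bool).
Variables (x : nat -> T -> 'cV[R]_N) (y : nat -> T -> 'cV[R]_q).
Variables (lam r rh : nat -> T -> 'cV[R]_p).
Hypothesis hmethod : rpdbcu A B b f g h beta rho etax etay x1 y1 S Y x y lam r rh.
Hypothesis g_proper : forall i, proper (@g i).
Hypothesis g_convex : forall i, econvex (@g i).
Hypothesis h_diff : forall v, differentiable h v.
Hypothesis nu_gt0 : 0 < nu.
Hypothesis h_convex : convex_with_modulus nu h.
Hypothesis (etax_gt0 : 0 < etax) (etay_gt0 : 0 < etay).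

Lemma residualE k w : (1 <= k)%N -> r k w = A *m x k w + B *m y k w - b.
Proof.
elim: k => [//|[_ _|k IH _]]; first exact: (rpdbcu_r1 hmethod).
rewrite (rpdbcu_r hmethod)// (rpdbcu_r_half hmethod)// IH//.
have -> : \sum_(i in S k.+1 w)
      submxrow A i *m (submxcol (x k.+2 w) i - submxcol (x k.+1 w) i)
    = A *m (x k.+2 w - x k.+1 w).
  rewrite (mulmx_blocks A) big_mkcond; apply: eq_bigr => i _.
  rewrite submxcolB; case: ifPn => // iS.
  by rewrite (rpdbcu_x_stay hmethod)// subrr mulmx0.
by rewrite !mulmxBr; apply/colP => i; rewrite !mxE; ring.
Qed.

(** The convention for [lam 0] is what makes this hold at k = 1. *)
Lemma dual_prevE k w : (1 <= k)%N -> lam k.-1 w = lam k w + rho *: r k w.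
Proof.
case: k => [//|[_|k _]]; first exact: (rpdbcu_lam0 hmethod).
by rewrite (rpdbcu_lam hmethod)// subrK.
Qed.

Lemma y_update_grad k w : (1 <= k)%N -> Y k w ->
  grad h (y k.+1 w) = B^T *m (lam k w - beta *: rh k w)
    - etay *: (y k.+1 w - y k w).
Proof.
move=> k1 Yk; apply: prox_grad => // u.
by have := rpdbcu_y_update hmethod k1 Yk u; rewrite lee_fin !norm2_sqr.
Qed.

Definition same_state k (w w' : T) :=
  [/\ x k w = x k w', y k w = y k w', lam k w = lam k w' & r k w = r k w'].

Lemma same_state_step k w w' : (1 <= k)%N -> same_state k w w' ->
  S k w = S k w' -> Y k w = Y k w' -> same_state k.+1 w w'.
Proof.
move=> k1 [xE yE lE rE] SE YE.
have xE' : x k.+1 w = x k.+1 w'.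
  apply/mxcolP => i; have [iS|iS] := boolP (i \in S k w); last first.
    by rewrite !(rpdbcu_x_stay hmethod) -?SE// xE.
  have iS' : i \in S k w' by rewrite -SE.
  have o := rpdbcu_x_update hmethod k1 iS'; rewrite -xE -lE -rE in o.
  exact: argmin_prox_unique etax_gt0 (g_proper i) (@g_convex i)
    (rpdbcu_x_update hmethod k1 iS) o.
have rhE : rh k w = rh k w' by rewrite !(rpdbcu_r_half hmethod)// rE SE xE' xE.
have yE' : y k.+1 w = y k.+1 w'.
  have [Yk|Yk] := boolP (Y k w); last by rewrite !(rpdbcu_y_stay hmethod) -?YE.
  have := y_update_grad k1 Yk; have := @y_update_grad k w' k1; rewrite -YE => /(_ Yk).
  rewrite -lE -rhE -yE => G2 G1.
  (* Both optimality conditions give a gradient difference -etay D, which strong monotonicity allows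
     only for D = 0. *)
  have := convex_grad_monotone (y k.+1 w) (y k.+1 w') h_convex h_diff.
  set D := y k.+1 w - y k.+1 w'.
  have -> : grad h (y k.+1 w) - grad h (y k.+1 w') = - (etay *: D).
    by rewrite G1 G2 /D; apply/colP => i; rewrite !mxE; ring.
  rewrite innerNr innerZr => H.
  have : (nu + etay) * inner D D <= 0 by lra.
  rewrite pmulr_rle0 ?addr_gt0//.
  rewrite le_eqVlt ltNge inner_ge0 orbF inner_eq0 subr_eq0 => /eqP//.
have rE' : r k.+1 w = r k.+1 w' by rewrite !residualE// xE' yE'.
by split=> //; rewrite !(rpdbcu_lam hmethod)// lE rE'.
Qed.

Lemma same_state_history K w w' : history S Y K w = history S Y K w' ->
  same_state K.+1 w w'.
Proof.
elim: K => [_|K IH HE].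
  have X w0 : same_state 1 w w0.
    have xw : x 1 w = x 1 w0 by rewrite !(rpdbcu_x1 hmethod).
    have yw : y 1 w = y 1 w0 by rewrite !(rpdbcu_y1 hmethod).
    by split=> //; [rewrite !(rpdbcu_lam1 hmethod)|rewrite !residualE// xw yw].
  exact: X.
have tE (i : 'I_K.+1) : (S i.+1 w, Y i.+1 w) = (S i.+1 w', Y i.+1 w').
  by have := congr1 (fun t => tnth t i) HE; rewrite !tnth_mktuple.
have [SE YE] : (S K.+1 w, Y K.+1 w) = (S K.+1 w', Y K.+1 w') by exact: (tE ord_max).
apply: same_state_step => //; apply: IH; apply: eq_from_tnth => i.
by rewrite !tnth_mktuple; exact: (tE (widen_ord (leqnSn K) i)).
Qed.

Lemma same_state_history_step K w w' :
  history_step S Y K w = history_step S Y K w' -> same_state K.+2 w w'.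
Proof.
move=> E; apply: same_state_step => //.
- exact: same_state_history (congr1 fst E).
- exact: (congr1 (fun a => a.2.1) E).
- exact: (congr1 (fun a => a.2.2) E).
Qed.

Lemma x_next_in_domain k w : (1 <= k)%N -> in_domain g (x k w) \/ S k w = finset.setT ->
  in_domain g (x k.+1 w).
Proof.
move=> k1 dS i; have [iS|iS] := boolP (i \in S k w).
  by have [] := argmin_prox (g_proper i) (econvex_strongly_convex0 (@g_convex i))
    (rpdbcu_x_update hmethod k1 iS).
rewrite (rpdbcu_x_stay hmethod)//; case: dS => [dx|ST]; first exact: dx.
by move: iS; rewrite ST inE.
Qed.

End Iteration.

(** * Linear convergence *)

(** Turns functions of the outcome into functions on F; w0 fills in for values that X never
    takes. *)
Lemma exists_representatives (T : Type) (F : finType) (X : T -> F) (w0 : T) :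
  exists rep : F -> T, forall w, X (rep (X w)) = X w.
Proof.
exists (fun a => if pselect (exists w, X w = a) is left e then sval (cid e) else w0).
move=> w; case: pselect => [e|[]]; last by exists w.
exact: (svalP (cid e)).
Qed.

Lemma exists_draw (M m : nat) (i : 'I_M) : (1 <= m <= M)%N ->
  exists s : {set 'I_M}, #|s| = m /\ i \in s.
Proof.
move=> /andP[m0 mM].
have : (0 < M * #|[set s : {set 'I_M} | (#|s| == m) && (i \in s)]%SET|)%N.
  by rewrite card_draws_mem// muln_gt0 m0 bin_gt0.
rewrite muln_gt0 => /andP[_ /card_gt0P[s]]; rewrite inE => /andP[/eqP sm si].
by exists s.
Qed.

Section LinearConvergence.
Context {R : realType} {M : nat} {n : 'I_M -> nat} {p q : nat}.
Context d {T : measurableType d} (Pr : probability T R).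
Local Notation N := (\sum_i n i)%N.
Variables (A : 'M[R]_(p, N)) (B : 'M[R]_(p, q)) (b : 'cV[R]_p).
Variables (f : 'cV[R]_N -> R) (g : forall i, 'cV[R]_(n i) -> \bar R).
Variable (h : 'cV[R]_q -> R).
Variables (m : nat) (theta mu nu Lm Lh : R).
Variables (alpha gamma beta rho etax etay c tau1 tau2 delta kappa sigma eta : R).
Variables (x1 : 'cV[R]_N) (y1 : 'cV[R]_q).
Variables (xs : 'cV[R]_N) (ys : 'cV[R]_q) (ls : 'cV[R]_p).
Variables (S : nat -> T -> {set 'I_M}) (Y : nat -> T -> bool).
Variables (x : nat -> T -> 'cV[R]_N) (y : nat -> T -> 'cV[R]_q).
Variables (lam r rh : nat -> T -> 'cV[R]_p).
Hypothesis hm : (1 <= m <= M)%N.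
Hypothesis thetaE : theta = m%:R / M%:R.
Hypothesis f_convex : convex_with_modulus 0 f.
Hypothesis f_diff : forall v, differentiable f v.
Hypothesis g_proper : forall i, proper (@g i).
Hypothesis g_convex : forall i, econvex (@g i).
Hypothesis mu_gt0 : 0 < mu.
Hypothesis g_strongly_convex : strongly_convex mu (gsum g).
Hypothesis f_partial_lip : partial_grad_lipschitz f m Lm.
Hypothesis h_diff : forall v, differentiable h v.
Hypothesis nu_gt0 : 0 < nu.
Hypothesis h_convex : convex_with_modulus nu h.
Hypothesis h_lip : lipschitz2 Lh (grad h).
Hypothesis kkt : is_KKT A B b f g h xs ys ls.
Hypothesis hsampling : sampling Pr m theta S Y.
Hypothesis hmethod : rpdbcu A B b f g h beta rho etax etay x1 y1 S Y x y lam r rh.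
Hypothesis (etax_gt0 : 0 < etax) (etay_gt0 : 0 < etay).

Local Notation P := (etax%:M - beta *: (A^T *m A)).
Local Notation Q := (etay%:M - beta *: (B^T *m B)).

Definition objective_gap (z : 'cV[R]_N) : R :=
  f z + gval g z - (f xs + gval g xs) - inner (A^T *m ls) (z - xs).

Definition gradient_gap (v : 'cV[R]_q) : R := inner (v - ys) (grad h v - grad h ys).

Definition dual_drift k w : R :=
  inner (lam k w - ls) (lam k w - ls)
  - (1 - theta) * inner (lam k.-1 w - ls) (lam k.-1 w - ls)
  + theta^-1 * inner (lam k w - lam k.-1 w) (lam k w - lam k.-1 w).

Definition psi_at k w : R :=
  lyapunov A B theta mu beta rho etax etay tau2
    (objective_gap (x k w)) (gradient_gap (y k w)) (x k w - xs) (y k w - ys)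
    (r k w) (dual_drift k w).

Lemma theta_bounds : 0 < theta <= 1.
Proof.
have /andP[m0 mM] := hm; have M0 : 0 < M%:R :> R by rewrite ltr0n (leq_trans m0).
apply/andP; split; first by rewrite thetaE divr_gt0// ltr0n.
by rewrite thetaE ler_pdivrMr// mul1r ler_nat.
Qed.

Lemma theta_eq1 : theta = 1 -> m = M.
Proof.
have /andP[m0 mM] := hm; have M0 : M%:R != 0 :> R by rewrite pnatr_eq0 -lt0n (leq_trans m0).
by rewrite thetaE => /divr1_eq/eqP; rewrite eqr_nat => /eqP.
Qed.

Lemma xs_in_domain : in_domain g xs.
Proof. by case: kkt => + _ _; exact: subdiff_in_domain. Qed.

Lemma objective_gap_ge z : in_domain g z ->
  mu / 2 * inner (z - xs) (z - xs) <= objective_gap z.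
Proof.
move=> dz; case: kkt => sub _ _.
have := subdiff_strong g_proper f_convex g_strongly_convex sub dz.
rewrite /objective_gap; lra.
Qed.

Lemma gradient_gap_ge v : nu * inner (v - ys) (v - ys) <= gradient_gap v.
Proof. exact: convex_grad_monotone. Qed.

Lemma Psi_in_domain z v : in_domain g z ->
  Psi A f g h xs ys ls z v = (objective_gap z + gradient_gap v)%:E.
Proof.
move=> dz; rewrite /Psi !objF_in_domain//; last exact: xs_in_domain.
Qed.

Lemma Psi_notin_domain z v : ~ in_domain g z -> Psi A f g h xs ys ls z v = +oo%E.
Proof.
move=> dz; rewrite /Psi (objF_notin_domain f g_proper dz).
by rewrite objF_in_domain//; exact: xs_in_domain.
Qed.

Lemma Psi_ge0 z v : (0 <= Psi A f g h xs ys ls z v)%E.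
Proof.
have [dz|dz] := pselect (in_domain g z); last by rewrite Psi_notin_domain.
rewrite Psi_in_domain// lee_fin addr_ge0//.
  by apply: le_trans (objective_gap_ge dz); rewrite mulr_ge0 ?inner_ge0// ltW// divr_gt0.
by apply: le_trans (gradient_gap_ge v); rewrite mulr_ge0 ?inner_ge0// ltW.
Qed.

Section FiniteExpansion.
Variables (F : finType) (X : T -> F) (rep : F -> T) (k : nat).
Hypothesis mX : forall a, measurable (X @^-1` [set a]).
Hypothesis repX : forall w, X (rep (X w)) = X w.
Hypothesis k_gt0 : (1 <= k)%N.
Hypothesis stateX : forall w w', X w = X w' -> same_state x y lam r k w w'.

Let lam_prev w w' : X w = X w' -> lam k.-1 w = lam k.-1 w'.
Proof.
by move=> /stateX[_ _ lE rE]; rewrite !(dual_prevE hmethod)// lE rE.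
Qed.

Let expE (phi : T -> R) : (forall w w', X w = X w' -> phi w = phi w') ->
  ('E_Pr[phi])%E = (\sum_a prob_of Pr X a * phi (rep a))%:E.
Proof.
move=> phiX; rewrite unlock -(integral_finite_valued Pr mX (fun a => phi (rep a))).
by apply: eq_integral => w _; rewrite (phiX w (rep (X w))).
Qed.

(** The integral of [Psi] is kept apart, being the only term that can be infinite. *)
Let psiE : psi A B f g h xs ys ls Pr x y lam r theta mu P Q beta rho tau2 k =
  ((1 - theta)%:E * \int[Pr]_w Psi A f g h xs ys ls (x k w) (y k w) +
   (\sum_a prob_of Pr X a * (psi_at k (rep a)
     - (1 - theta) * (objective_gap (x k (rep a)) + gradient_gap (y k (rep a)))))%:E)%E.
Proof.
pose phi2 w := norm2 (r k w) ^+ 2.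
pose phi3 w := wnormsq (P + (mu * (1 - theta))%:M) (x k w - xs).
pose phi4 w := wnormsq (Q + (beta * (1 - theta) / tau2) *: (B^T *m B)) (y k w - ys).
pose phi5 w := norm2 (lam k w - ls) ^+ 2 - (1 - theta) * norm2 (lam k.-1 w - ls) ^+ 2
   + theta^-1 * norm2 (lam k w - lam k.-1 w) ^+ 2.
pose E phi := \sum_a prob_of Pr X a * phi (rep a).
have -> : psi A B f g h xs ys ls Pr x y lam r theta mu P Q beta rho tau2 k =
  ((1 - theta)%:E * \int[Pr]_w Psi A f g h xs ys ls (x k w) (y k w)
   + (beta * (1 - theta) / 2 * E phi2)%:E + (2^-1 * E phi3)%:E + (2^-1 * E phi4)%:E
   + ((2 * rho)^-1 * E phi5)%:E)%E.
  rewrite /psi !EFinM; congr (_ + _ * _ + _ * _ + _ * _ + _ * _)%E; apply: expE.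
  - by move=> w w' /stateX[_ _ _ rE]; rewrite /phi2 rE.
  - by move=> w w' /stateX[xE _ _ _]; rewrite /phi3 xE.
  - by move=> w w' /stateX[_ yE _ _]; rewrite /phi4 yE.
  - move=> w w' XE; rewrite /phi5 (lam_prev XE).
    by have [_ _ -> _] := stateX XE.
rewrite -!addeA -!EFinD; congr (_ + _%:E)%E.
rewrite /E !mulr_sumr -!big_split; apply: eq_bigr => a _ /=.
rewrite /psi_at /lyapunov /dual_drift /phi2 /phi3 /phi4 /phi5 !norm2_sqr; ring.
Qed.

(** For theta = 1 the Psi term is 0 even if its integral is +oo. *)
Lemma psi_fin : theta = 1 \/ (forall w, in_domain g (x k w)) ->
  psi A B f g h xs ys ls Pr x y lam r theta mu P Q beta rho tau2 k =
  (\sum_a prob_of Pr X a * psi_at k (rep a))%:E.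
Proof.
move=> dom.
pose phi w := objective_gap (x k w) + gradient_gap (y k w).
have I1E : ((1 - theta)%:E * \int[Pr]_w Psi A f g h xs ys ls (x k w) (y k w) =
    ((1 - theta) * \sum_a prob_of Pr X a * phi (rep a))%:E)%E.
  case: dom => [->|dom]; first by rewrite subrr mul0e mul0r.
  rewrite EFinM; congr (_ * _)%E.
  rewrite -(integral_finite_valued Pr mX (fun a => phi (rep a))).
  apply: eq_integral => w _; rewrite Psi_in_domain// /phi.
  by have [-> -> _ _] := stateX (repX w).
rewrite psiE I1E -EFinD; congr (_%:E).
rewrite mulr_sumr -big_split; apply: eq_bigr => a _ /=; rewrite /phi; ring.
Qed.

Lemma psi_pinfty w : theta < 1 -> ~ in_domain g (x k w) -> prob_of Pr X (X w) != 0 ->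
  psi A B f g h xs ys ls Pr x y lam r theta mu P Q beta rho tau2 k = +oo%E.
Proof.
move=> t1 dw pw.
have I1E : ((1 - theta)%:E * \int[Pr]_w Psi A f g h xs ys ls (x k w) (y k w) = +oo)%E.
  have -> : (\int[Pr]_w Psi A f g h xs ys ls (x k w) (y k w) = +oo)%E.
    pose phi a := Psi A f g h xs ys ls (x k (rep a)) (y k (rep a)).
    transitivity (\int[Pr]_w phi (X w))%E.
      apply: eq_integral => w' _; rewrite /phi.
      by have [-> -> _ _] := stateX (repX w').
    apply: (integral_finite_valued_pinfty mX _ _ pw); first by move=> a; exact: Psi_ge0.
    rewrite /phi Psi_notin_domain//; have [-> _ _ _] := stateX (repX w).
    exact: dw.
  by rewrite gt0_muley// lte_fin subr_gt0.
by rewrite psiE I1E addye.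
Qed.

End FiniteExpansion.

Hypothesis alpha01 : 0 < alpha < theta.
Hypothesis gamma_gt0 : 0 < gamma.
Hypothesis rhoE : rho = theta * beta.
Hypothesis (beta_gt0 : 0 < beta) (c_gt0 : 0 < c).
Hypothesis (tau1_gt0 : 0 < tau1) (tau2_gt0 : 0 < tau2).
Hypothesis delta_ge0 : 0 <= delta.
Hypothesis delta_gt0 : theta < 1 -> 0 < delta.
Hypothesis kappa_ge0 : 0 <= kappa.
Hypothesis gammaA : 8 * spectral_norm A ^+ 2 / (alpha * mu) <= gamma.
Hypothesis gammaB : 8 * spectral_norm B ^+ 2 / (alpha * nu) <= gamma.
Hypothesis (A_le1 : spectral_norm A <= 1) (B_le1 : spectral_norm B <= 1).
Hypothesis delta_kappa :
    psd_ge (2 *: mx2 (1 - (1 - theta) * (1 + delta))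
                     ((1 - theta) * (1 + delta))
                     ((1 - theta) * (1 + delta))
                     (kappa - (1 - theta) * (1 + delta)))
           (mx2 theta (1 - theta) (1 - theta) (theta^-1 - (1 - theta))).
Hypothesis P_ge : psd_ge P ((beta * (1 - theta) * tau2) *: (A^T *m A) + Lm%:M).
Hypothesis Q_ge : psd_ge Q
    ((8 * c) *: (Q^T *m Q)
     + (4 * c * rho ^+ 2 * ((1 - theta) * (1 + delta^-1))) *:
         (B^T *m B *m B^T *m B)
     + (beta * tau1) *: (B^T *m B)).
Hypothesis sigma_ge0 : 0 <= sigma.
Hypothesis sigma_le1 : sigma <= 1.
Hypothesis sigma_le : forall v, sigma * inner v v <= inner (B^T *m v) (B^T *m v).
Hypothesis eta_ge1 : 1 <= eta.
Hypothesis eta_Psi : eta * (1 - theta) <= 1 - alpha.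
Hypothesis eta_x : (eta - 1) * (etax + mu * (1 - theta)) <=
  alpha / 2 * mu + theta * mu - beta / tau1.
Hypothesis eta_y : (eta - 1) * (etay / 2 + beta * (1 - theta) / (2 * tau2)) <=
  3 * alpha * nu / 4 - 4 * c * Lh ^+ 2 - beta * (1 - theta) / (2 * tau2).
Hypothesis eta_r : (eta - 1) * (beta * (1 - theta)) <=
  2 / gamma - 2 * c * rho ^+ 2 * (kappa + 2 * ((1 - theta) * (1 + delta^-1)))
  - 4 * c * (beta - rho) ^+ 2.
Hypothesis eta_lam : eta - 1 <= c * rho * sigma.

Lemma residual_at k w : (1 <= k)%N -> r k w = A *m (x k w - xs) + B *m (y k w - ys).
Proof.
move=> k1; case: kkt => _ _ feas; rewrite (residualE hmethod)// -feas !mulmxBr.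
by rewrite opprD addrACA.
Qed.

Lemma half_residual_at k w : (1 <= k)%N ->
  rh k w = A *m (x k.+1 w - xs) + B *m (y k w - ys).
Proof.
move=> k1; have := residual_at w (ltn0Sn k); rewrite (rpdbcu_r hmethod)// => H.
have -> : rh k w = rh k w + B *m (y k.+1 w - y k w) - B *m (y k.+1 w - y k w).
  by rewrite addrK.
by rewrite H !mulmxBr; apply/colP => i; rewrite !mxE; ring.
Qed.

Lemma gradient_lipschitz_at v :
  inner (grad h v - grad h ys) (grad h v - grad h ys) <=
  Lh ^+ 2 * inner (v - ys) (v - ys).
Proof.
rewrite -!norm2_sqr -exprMn ler_pXn2r ?nnegrE ?norm2_ge0//.
by apply: le_trans (h_lip v ys); exact: norm2_ge0.
Qed.

Lemma dual_drift_next k w : (1 <= k)%N ->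
  dual_drift k.+1 w = dual_growth theta rho (lam k w - ls) (r k.+1 w).
Proof.
move=> k1; rewrite /dual_drift /dual_growth /= (rpdbcu_lam hmethod)//.
rewrite [lam k w - _ - ls]addrAC [lam k w - _ - lam k w]addrAC subrr add0r.
by rewrite innerNl innerNr opprK.
Qed.

Lemma dual_drift_prev k w : (1 <= k)%N -> let L := lam k w - ls in
  dual_drift k w = inner L L - (1 - theta) * inner (L + rho *: r k w) (L + rho *: r k w)
    + theta^-1 * inner (rho *: r k w) (rho *: r k w).
Proof.
move=> k1 /=; rewrite /dual_drift (dual_prevE hmethod)//.
rewrite [lam k w + _ - ls]addrAC opprD addrA subrr add0r.
by rewrite innerNl innerNr opprK.
Qed.

Section OneStep.
Variables (k : nat) (w0 : T).
Hypothesis k_gt0 : (1 <= k)%N.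
(** An outcome for each possible next choice after the history of w0; if theta = 1, a false coin has
    probability 0 and no outcome is demanded. *)
Variable rep : {set 'I_M} -> bool -> T.
Hypothesis rep_state : forall (s : {set 'I_M}) e, #|s| = m -> (e = false -> theta < 1) ->
  [/\ same_state x y lam r k (rep s e) w0, S k (rep s e) = s & Y k (rep s e) = e].
Hypothesis dom : theta = 1 \/ in_domain g (x k w0).

Let v := lam k w0 - beta *: r k w0.

(* z collects, for each block, the value it takes whenever it is selected. *)
Let full_update : exists z, (forall i, is_argmin (fun u : 'cV[R]_(n i) =>
     ((inner (submxcol (grad f (x k w0)) i - (submxrow A i)^T *m v) u)%:E + g u
      + (etax / 2 * norm2 (u - submxcol (x k w0) i) ^+ 2)%:E)%E) (submxcol z i)) /\
  forall (s : {set 'I_M}) e, #|s| = m -> (e = false -> theta < 1) ->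
    x k.+1 (rep s e) = replace_blocks s (x k w0) z.
Proof.
(* Block i of z is read off from one draw containing i; by uniqueness of minimisers the choice is
   immaterial. *)
have sel i : {s : {set 'I_M} | #|s| = m /\ i \in s} by apply/cid/exists_draw.
pose z := \mxcol_i submxcol (x k.+1 (rep (sval (sel i)) true)) i.
have opt (s : {set 'I_M}) e i : #|s| = m -> (e = false -> theta < 1) -> i \in s ->
    is_argmin (fun u : 'cV[R]_(n i) =>
     ((inner (submxcol (grad f (x k w0)) i - (submxrow A i)^T *m v) u)%:E + g u
      + (etax / 2 * norm2 (u - submxcol (x k w0) i) ^+ 2)%:E)%E)
      (submxcol (x k.+1 (rep s e)) i).
  move=> sm et si; have [[xE _ lE rE] SE _] := rep_state sm et.
  have iS : i \in S k (rep s e) by rewrite SE.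
  by have := rpdbcu_x_update hmethod k_gt0 iS; rewrite xE lE rE.
have zopt i : is_argmin (fun u : 'cV[R]_(n i) =>
     ((inner (submxcol (grad f (x k w0)) i - (submxrow A i)^T *m v) u)%:E + g u
      + (etax / 2 * norm2 (u - submxcol (x k w0) i) ^+ 2)%:E)%E) (submxcol z i).
  by rewrite mxcolK; have [sm si] := svalP (sel i); exact: opt.
exists z; split=> // s e sm et; apply/mxcolP => i; rewrite submxcol_replace.
case: ifPn => si.
  exact: argmin_prox_unique etax_gt0 (g_proper i) (@g_convex i) (opt s e i sm et si) (zopt i).
have [[xE _ _ _] SE _] := rep_state sm et.
by rewrite (rpdbcu_x_stay hmethod)// ?xE// SE.
Qed.

Lemma one_step : eta * ('C(M, m)%:R^-1 * \sum_(s : {set 'I_M} | #|s| == m)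
    (theta * psi_at k.+1 (rep s true) + (1 - theta) * psi_at k.+1 (rep s false))) <=
  psi_at k w0.
Proof.
have [z [zopt xE]] := full_update.
have [dz avg] := block_step_average g_proper hm f_convex f_diff f_partial_lip
  g_strongly_convex xs_in_domain zopt.
rewrite -thetaE in avg; move: avg.
set bound := f (x k w0) + gval g (x k w0) + theta * _ => avg.
pose U s := let x' := replace_blocks s (x k w0) z in
  f x' + gval g x' - Lm / 2 * inner (x' - x k w0) (x' - x k w0)
  + etax * inner (x' - x k w0) (x' - xs)
  + mu / 2 * (inner (x' - xs) (x' - xs) - inner (x k w0 - xs) (x k w0 - xs))
  - inner v (A *m (x' - x k w0)).
have [t0 t1] := andP theta_bounds; have t1' : 0 <= 1 - theta by rewrite subr_ge0.
have tt (e : bool) : e = true -> (e = false -> theta < 1) by move->.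
(* Here Z = U s - bound, whose average over draws is at most 0 by [avg]. *)
have step (s : {set 'I_M}) : #|s| = m ->
    eta * (theta * psi_at k.+1 (rep s true) + (1 - theta) * psi_at k.+1 (rep s false))
    <= psi_at k w0 + (U s - bound).
  move=> sm; set x' := replace_blocks s (x k w0) z.
  have dx' : in_domain g x'.
    move=> i; rewrite submxcol_replace; case: ifPn => si; first exact: dz.
    case: dom => [/theta_eq1 mM|dx]; last exact: dx.
    have sT : s = finset.setT by apply/eqP; rewrite eqEcard finset.subsetT cardsT card_ord sm mM leqnn.
    by move: si; rewrite sT inE.
  have [[xwt ywt lwt rwt] Swt Ywt] := rep_state sm (tt true erefl).
  set wt := rep s true in xwt ywt lwt rwt Swt Ywt *.
  pose ut := y k.+1 wt - ys.
  pose rhs := A *m (x' - xs) + B *m (y k w0 - ys).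
  pose rts := A *m (x' - xs) + B *m ut.
  have rhE : rh k wt = rhs by rewrite half_residual_at// xE// ywt.
  have gtE : grad h (y k.+1 wt) - grad h ys =
      B^T *m (lam k w0 - ls - beta *: rhs) - etay *: (ut - (y k w0 - ys)).
    case: kkt => _ -> _; rewrite (y_update_grad hmethod h_diff k_gt0 Ywt).
    rewrite rhE lwt ywt /ut !mulmxBr -!scalemxAr.
    by apply/colP => i; rewrite !mxE; ring.
  have gapE : objective_gap x' = (U s - bound) + (1 - theta) * objective_gap (x k w0)
      + (1 - theta) * mu / 2 * inner (x k w0 - xs) (x k w0 - xs)
      - mu / 2 * inner (x' - xs) (x' - xs)
      + Lm / 2 * inner (x' - xs - (x k w0 - xs)) (x' - xs - (x k w0 - xs))
      - etax * inner (x' - xs - (x k w0 - xs)) (x' - xs)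
      + inner (lam k w0 - ls - beta *: r k w0) (A *m (x' - xs))
      - (1 - theta) * inner (lam k w0 - ls - beta *: r k w0) (A *m (x k w0 - xs)).
    have -> : x' - xs - (x k w0 - xs) = x' - x k w0 by rewrite opprB addrA subrK.
    have -> : lam k w0 - ls - beta *: r k w0 = v - ls by rewrite addrAC.
    rewrite /objective_gap /bound /U -/x' !inner_trmx.
    have -> : A *m (x' - x k w0) = A *m (x' - xs) - A *m (x k w0 - xs).
      by rewrite -mulmxBr opprB addrA subrK.
    by rewrite -/v !innerBr !innerBl; ring.
  have coin := coin_step theta_bounds alpha01 mu_gt0 nu_gt0 gamma_gt0 rhoE beta_gt0
    c_gt0 tau1_gt0 tau2_gt0 delta_ge0 delta_gt0 kappa_ge0 gammaA gammaB A_le1 B_le1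
    delta_kappa P_ge Q_ge sigma_ge0 sigma_le1 sigma_le eta_ge1 eta_Psi eta_x eta_y
    eta_r eta_lam (residual_at w0 k_gt0) (erefl rhs) (erefl rts) (objective_gap_ge dx')
    (gradient_gap_ge (y k w0)) (gradient_gap_ge (y k.+1 wt)) (erefl _)
    (gradient_lipschitz_at (y k.+1 wt)) gtE gapE.
  rewrite -dual_drift_prev// -/(psi_at k w0) in coin.
  have next w : same_state x y lam r k w w0 -> x k.+1 w = x' ->
      psi_at k.+1 w = lyapunov A B theta mu beta rho etax etay tau2 (objective_gap x')
        (gradient_gap (y k.+1 w)) (x' - xs) (y k.+1 w - ys)
        (A *m (x' - xs) + B *m (y k.+1 w - ys))
        (dual_growth theta rho (lam k w0 - ls) (A *m (x' - xs) + B *m (y k.+1 w - ys))).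
    move=> [_ _ lE _] xw; rewrite /psi_at dual_drift_next// residual_at// xw lE.
    by [].
  suff -> : theta * psi_at k.+1 wt + (1 - theta) * psi_at k.+1 (rep s false) =
    theta * lyapunov A B theta mu beta rho etax etay tau2 (objective_gap x')
      (gradient_gap (y k.+1 wt)) (x' - xs) ut rts
      (dual_growth theta rho (lam k w0 - ls) rts)
    + (1 - theta) * lyapunov A B theta mu beta rho etax etay tau2 (objective_gap x')
      (gradient_gap (y k w0)) (x' - xs) (y k w0 - ys) rhs
      (dual_growth theta rho (lam k w0 - ls) rhs) by exact: coin.
  rewrite (next wt) ?xE//; congr (_ + _).
  have [theta1|t1n] := eqVneq theta 1; first by rewrite theta1 subrr !mul0r.
  have t1lt : theta < 1 by rewrite lt_neqAle t1n.
  have [same Sf Yf] := rep_state sm (fun _ : false = false => t1lt).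
  congr (_ * _); rewrite (next (rep s false)) ?xE//.
  have -> : y k.+1 (rep s false) = y k w0.
    by rewrite (rpdbcu_y_stay hmethod) ?Yf//; case: same.
  by [].
have C0 : 0 <= 'C(M, m)%:R^-1 :> R by rewrite invr_ge0.
rewrite mulrCA mulr_sumr.
apply: le_trans (_ : 'C(M, m)%:R^-1 * (\sum_(s : {set 'I_M} | #|s| == m)
   ((psi_at k w0 - bound) + U s)) <= _).
  apply: ler_wpM2l => //; apply: ler_sum => s /eqP sm.
  by apply: le_trans (step s sm) _; rewrite addrCA addrC.
rewrite big_split /= mulrDr subset_average_cst; last by case/andP: hm.
have : 'C(M, m)%:R^-1 * (\sum_(s : {set 'I_M} | #|s| == m) U s) <= bound by exact: avg.
lra.
Qed.

End OneStep.
Lemma psi_contraction k : (1 <= k)%N ->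
  (psi A B f g h xs ys ls Pr x y lam r theta mu P Q beta rho tau2 k.+1 <=
   (eta^-1)%:E *
   psi A B f g h xs ys ls Pr x y lam r theta mu P Q beta rho tau2 k)%E.
Proof.
case: k => // K _; have eta0 : 0 < eta by apply: lt_le_trans eta_ge1.
have [t0 t1] := andP theta_bounds.
have [w0 _] : exists w : T, True.
  apply: contrapT => /forallNP noT.
  have := probability_setT Pr; rewrite (_ : setT = set0) ?measure0; last first.
    by apply/seteqP; split=> // w _; exact: (noT w).
  by move/eqP; rewrite eq_sym onee_eq0.
have [rep repX] := exists_representatives (history S Y K) w0.
have [rep' repX'] := exists_representatives (history_step S Y K) w0.
have mX := @history_measurable _ _ _ _ Pr _ _ _ _ hsampling K.
have mX' := @history_step_measurable _ _ _ _ Pr _ _ _ _ hsampling K.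
have stX w w' := @same_state_history _ _ _ _ _ _ _ _ _ _ _ _ _ _ _ _ _ _ _ _ _ _ _ _
  _ _ _ hmethod g_proper g_convex h_diff nu_gt0 h_convex etax_gt0 etay_gt0 K w w'.
have stX' w w' := @same_state_history_step _ _ _ _ _ _ _ _ _ _ _ _ _ _ _ _ _ _ _ _ _ _ _ _
  _ _ _ hmethod g_proper g_convex h_diff nu_gt0 h_convex etax_gt0 etay_gt0 K w w'.
have [dom|ndom] := pselect (theta = 1 \/ forall w, in_domain g (x K.+1 w)); last first.
  move/not_orP: ndom => [/eqP t1n /existsNP[w dw]].
  have t1lt : theta < 1 by rewrite lt_neqAle t1n.
  rewrite (psi_pinfty mX repX (ltn0Sn K) stX t1lt dw); last first.
    by apply: history_prob_neq0 hsampling _ _ _ _ => //; rewrite t0.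
  by rewrite gt0_muley ?leey// lte_fin invr_gt0.
have dom' : theta = 1 \/ forall w, in_domain g (x K.+2 w).
  case: dom => [|dom]; [by left|right=> w].
  by apply: (x_next_in_domain hmethod g_proper g_convex) => //; left.
rewrite (psi_fin mX repX (ltn0Sn K) stX dom) (psi_fin mX' repX' (ltn0Sn K.+1) stX' dom').
rewrite -EFinM lee_fin (history_step_sum hsampling) mulr_sumr; apply: ler_sum => t _.
(* Histories of probability 0 contribute nothing and need not be realised by any outcome. *)
have [->|pt] := eqVneq (prob_of Pr (history S Y K) t) 0; first by rewrite !mul0r mulr0.
rewrite [leRHS]mulrCA; apply: ler_wpM2l; first exact: prob_of_ge0.
rewrite -ler_pdivrMl ?invr_gt0// invrK.
have Ht : history S Y K (rep t) = t by have [w <-] := prob_of_gt0_ex pt.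
apply: (@one_step K.+1 (rep t) (ltn0Sn K) (fun s e => rep' (t, (s, e)))).
  move=> s e sm et.
  have : prob_of Pr (history_step S Y K) (t, (s, e)) != 0.
    rewrite (history_step_prob hsampling) !mulf_neq0//.
      rewrite (prob_of_set hsampling)// sm eqxx invr_neq0// pnatr_eq0 -lt0n bin_gt0.
      by case/andP: hm.
    rewrite (prob_of_coin hsampling)//=; case: e et => [_|/(_ erefl) t1lt].
      by rewrite gt_eqF.
    by rewrite gt_eqF// subr_gt0.
  move=> /prob_of_gt0_ex[w Xw].
  have E : history_step S Y K (rep' (t, (s, e))) = (t, (s, e)) by rewrite -Xw repX'.
  split.
  - by apply: stX; rewrite Ht; exact: (congr1 fst E).
  - exact: (congr1 (fun a => a.2.1) E).
  - exact: (congr1 (fun a => a.2.2) E).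
by case: dom => [|dom]; [left|right].
Qed.

End LinearConvergence.

Lemma spectral_norm0 {R : realType} (k n : nat) :
  spectral_norm (0 : 'M[R]_(k, n)) = 0.
Proof.
rewrite /spectral_norm (_ : [set _ | _ in _] = [set 0]) ?sup1//.
have z0 (v : 'cV[R]_n) : norm2 ((0 : 'M[R]_(k, n)) *m v) = 0.
  by rewrite mul0mx /norm2 inner0l sqrtr0.
apply/seteqP; split=> [_ [v _ <-]|_ ->]; first exact: z0.
by exists 0 => //=; rewrite /norm2 inner0l sqrtr0.
Qed.

(** * Quotients with a possibly zero denominator *)

Section ExtendedQuotients.
Context {R : realType}.
Implicit Types a b e : R.

Lemma lt1_ediv a b : 0 <= b < a -> (1 < a%:E / b%:E)%E.
Proof.
move=> /andP[b0 ba]; rewrite inver; case: eqVneq => [_|bN0].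
  by rewrite gt0_muley ?ltry// lte_fin (le_lt_trans b0).
by rewrite -EFinM lte_fin ltr_pdivlMr ?mul1r// lt_def bN0.
Qed.

Lemma lt1_adde_ediv a b : 0 < a -> 0 <= b -> (1 < 1 + a%:E / b%:E)%E.
Proof.
move=> a0 b0; rewrite inver; case: eqVneq => [_|bN0].
  by rewrite gt0_muley ?lte_fin// addey// ltry.
by rewrite -EFinM -EFinD lte_fin ltrDl divr_gt0// lt_def bN0.
Qed.

Lemma ediv_le a b e : 0 <= a -> 0 <= b -> (e%:E <= a%:E / b%:E)%E -> e * b <= a.
Proof.
move=> a0 b0; rewrite inver; case: eqVneq => [-> _|bN0]; first by rewrite mulr0.
by rewrite -EFinM lee_fin ler_pdivlMr// lt_def bN0.
Qed.

Lemma adde_ediv_le a b e : 0 <= a -> 0 <= b -> (e%:E <= 1 + a%:E / b%:E)%E ->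
  (e - 1) * b <= a.
Proof.
move=> a0 b0; rewrite inver; case: eqVneq => [-> _|bN0]; first by rewrite mulr0.
by rewrite -EFinM -EFinD lee_fin -lerBlDl ler_pdivlMr// lt_def bN0.
Qed.

End ExtendedQuotients.

Theorem theorem4p3 (R : realType) (M : nat) (n : 'I_M -> nat) (p q : nat)
  (A : 'M[R]_(p, (\sum_i n i)%N)) (B : 'M[R]_(p, q)) (b : 'cV[R]_p)
  (f : 'cV[R]_((\sum_i n i)%N) -> R)
  (g : forall i : 'I_M, 'cV[R]_(n i) -> \bar R)
  (h : 'cV[R]_q -> R)
  (m : nat) (theta mu nu Lm Lh : R)
  (alpha gamma : R)
  (beta rho etax etay c tau1 tau2 delta kappa : R)
  (P : 'M[R]_((\sum_i n i)%N)) (Q : 'M[R]_q) (eta : \bar R)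
  (xs : 'cV[R]_((\sum_i n i)%N)) (ys : 'cV[R]_q) (ls : 'cV[R]_p)
  (d : measure_display) (T : measurableType d) (Pr : probability T R)
  (x1 : 'cV[R]_((\sum_i n i)%N)) (y1 : 'cV[R]_q)
  (S : nat -> T -> {set 'I_M}) (Y : nat -> T -> bool)
  (x : nat -> T -> 'cV[R]_((\sum_i n i)%N)) (y : nat -> T -> 'cV[R]_q)
  (lam r rh : nat -> T -> 'cV[R]_p)
  (hm : (1 <= m <= M)%N)
  (htheta : theta = m%:R / M%:R)
  (f_convex : @convex_function R 'cV[R]_((\sum_i n i)%N) setT f)
  (f_diff : forall v, differentiable f v)
  (g_proper : forall i, proper (g i))
  (g_closed : forall i, lower_semicontinuous (g i))
  (g_convex : forall i, econvex (g i))
  (mu_gt0 : 0 < mu)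
  (g_strongly_convex : strongly_convex mu (gsum g))
  (f_partial_lip : partial_grad_lipschitz f m Lm)
  (h_diff : forall v, differentiable h v)
  (nu_gt0 : 0 < nu)
  (h_strongly_convex : strongly_convex nu (EFin \o h))
  (h_lip : lipschitz2 Lh (grad h))
  (kkt : is_KKT A B b f g h xs ys ls)
  (hrho : rho = theta * beta)
  (hsampling : sampling Pr m theta S Y)
  (hmethod : rpdbcu A B b f g h beta rho etax etay x1 y1 S Y x y lam r rh)
  (halpha : 0 < alpha < theta)
  (hgamma : gamma = Num.max (8 * spectral_norm A ^+ 2 / (alpha * mu))
                            (8 * spectral_norm B ^+ 2 / (alpha * nu)))
  (B_full_row_rank : row_free B)
  (AB_norm : Num.max (spectral_norm A) (spectral_norm B) <= 1)
  (hP : P = etax%:M - beta *: (A^T *m A))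
  (hQ : Q = etay%:M - beta *: (B^T *m B))
  (delta_ge0 : 0 <= delta) (delta_gt0 : theta < 1 -> 0 < delta)
  (kappa_ge0 : 0 <= kappa)
  (etax_gt0 : 0 < etax) (etay_gt0 : 0 < etay) (c_gt0 : 0 < c)
  (tau1_gt0 : 0 < tau1) (tau2_gt0 : 0 < tau2) (beta_gt0 : 0 < beta)
  (delta_kappa :
    psd_ge (2 *: mx2 (1 - (1 - theta) * (1 + delta))
                     ((1 - theta) * (1 + delta))
                     ((1 - theta) * (1 + delta))
                     (kappa - (1 - theta) * (1 + delta)))
           (mx2 theta (1 - theta) (1 - theta) (theta^-1 - (1 - theta))))
  (P_ge : psd_ge P ((beta * (1 - theta) * tau2) *: (A^T *m A) + Lm%:M))
  (Q_ge : psd_ge Q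
    ((8 * c) *: (Q^T *m Q)
     + (4 * c * rho ^+ 2 * ((1 - theta) * (1 + delta^-1))) *:
         (B^T *m B *m B^T *m B)
     + (beta * tau1) *: (B^T *m B)))
  (cond_mu : alpha / 2 * mu + theta * mu > beta / tau1)
  (cond_nu : 3 * alpha * nu / 4
             > 4 * c * Lh ^+ 2 + beta * (1 - theta) / (2 * tau2))
  (cond_gamma : gamma^-1
     > c * rho ^+ 2 * (kappa + 2 * ((1 - theta) * (1 + delta^-1)))
       + 2 * c * (beta - rho) ^+ 2)
  (* division and inverse in \bar R: if theta = 1, the denominators 1 - theta
     and beta * (1 - theta) are 0 and their entries are +oo *)
  (heta : eta =
    (mine ((1 - alpha)%:E / (1 - theta)%:E)
   (mine (1 + (alpha / 2 * mu + theta * mu - beta / tau1)%:E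
              / (etax + mu * (1 - theta))%:E)
   (mine (1 + (3 * alpha * nu / 4 - 4 * c * Lh ^+ 2
               - beta * (1 - theta) / (2 * tau2))%:E
              / (etay / 2 + beta * (1 - theta) / (2 * tau2))%:E)
   (mine (1 + (2 / gamma
               - 2 * c * rho ^+ 2
                 * (kappa + 2 * ((1 - theta) * (1 + delta^-1)))
               - 4 * c * (beta - rho) ^+ 2)%:E
              / (beta * (1 - theta))%:E)
         (1 + (c * rho * sigma_min (B *m B^T))%:E)))))%E) :
  (1 < eta)%E /\
  forall k : nat, (1 <= k)%N ->
    (psi A B f g h xs ys ls Pr x y lam r theta mu P Q beta rho tau2 k.+1
     <= eta^-1 *
        psi A B f g h xs ys ls Pr x y lam r theta mu P Q beta rho tau2 k)%E.
Proof.
have theta01 := theta_bounds hm htheta; have [t0 t1] := andP theta01.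
have t1' : 0 <= 1 - theta by rewrite subr_ge0.
have [al0 alt] := andP halpha.
have rho0 : 0 < rho by rewrite hrho mulr_gt0.
have k1_ge0 : 0 <= (1 - theta) * (1 + delta^-1).
  by rewrite mulr_ge0// addr_ge0// invr_ge0.
have gamma0 : 0 < gamma.
  rewrite -invr_gt0; apply: le_lt_trans cond_gamma.
  by repeat first [done | exact: sqr_ge0 | exact: ltW | apply: addr_ge0 | apply: mulr_ge0].
(* With p = 0 both spectral norms vanish, so gamma would be 0. Positivity of p makes the set in
   [sigma_min] nonempty. *)
have p0 : (0 < p)%N.
  rewrite lt0n; apply/eqP => pE; move: gamma0; rewrite hgamma.
  have no (k : nat) (C : 'M[R]_(p, k)) : C = 0.
    by apply/matrixP => i; have := ltn_ord i; rewrite {2}pE.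
  by rewrite (no _ A) (no _ B) !spectral_norm0 expr0n /= mulr0 !mul0r maxxx ltxx.
have [sigma0 sigma_le] := sigma_min_gram p0 B_full_row_rank.
set sigma := sigma_min (B *m B^T) in sigma0 sigma_le heta.
move: AB_norm; rewrite ge_max => /andP[A1 B1].
(* Test sigma |v|^2 <= |B^T v|^2 <= |v|^2 on a basis vector. *)
have sigma1 : sigma <= 1.
  pose v : 'cV[R]_p := delta_mx (Ordinal p0) 0.
  have v0 : 0 < inner v v.
    rewrite inner_gt0; apply/eqP => /matrixP/(_ (Ordinal p0) 0)/eqP.
    by rewrite !mxE !eqxx oner_eq0.
  have := le_trans (sigma_le v) (inner_trmx_mulmx_le1 v B1).
  by rewrite -[leRHS]mul1r ler_pM2r.
have gammaA : 8 * spectral_norm A ^+ 2 / (alpha * mu) <= gamma.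
  by rewrite hgamma le_max lexx.
have gammaB : 8 * spectral_norm B ^+ 2 / (alpha * nu) <= gamma.
  by rewrite hgamma le_max lexx orbT.
set a2 := alpha / 2 * mu + theta * mu - beta / tau1 in heta.
set b2 := etax + mu * (1 - theta) in heta.
set a3 := 3 * alpha * nu / 4 - 4 * c * Lh ^+ 2 - beta * (1 - theta) / (2 * tau2) in heta.
set b3 := etay / 2 + beta * (1 - theta) / (2 * tau2) in heta.
set a4 := 2 / gamma - 2 * c * rho ^+ 2
  * (kappa + 2 * ((1 - theta) * (1 + delta^-1))) - 4 * c * (beta - rho) ^+ 2 in heta.
have a2_gt0 : 0 < a2 by rewrite subr_gt0.
have a3_gt0 : 0 < a3 by rewrite /a3; move: cond_nu; lra.
have a4_gt0 : 0 < a4 by rewrite /a4; move: cond_gamma; lra.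
have b2_ge0 : 0 <= b2 by rewrite addr_ge0 ?mulr_ge0// ltW.
have b3_ge0 : 0 <= b3.
  by repeat first [done | rewrite invr_ge0 | exact: ltW | apply: addr_ge0 | apply: mulr_ge0].
have b4_ge0 : 0 <= beta * (1 - theta) by rewrite mulr_ge0// ltW.
have a5_gt0 : 0 < c * rho * sigma by rewrite !mulr_gt0.
have eta_gt1 : (1 < eta)%E.
  rewrite heta !lt_min !lt1_adde_ediv// -EFinD lte_fin ltrDl a5_gt0 lt1_ediv//.
  by rewrite t1' /=; lra.
split=> //.
have : (eta <= eta)%E by [].
rewrite {2}heta !le_min => /andP[e1 /andP[e2 /andP[e3 /andP[e4 e5]]]].
(* The last entry of the minimum is always finite. *)
have eta_fin : eta \is a fin_num.
  move: eta_gt1 e5; rewrite -EFinD; case: (eta) => //.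
rewrite -(fineK eta_fin) in eta_gt1 e1 e2 e3 e4 e5 *.
set er := fine eta in eta_gt1 e1 e2 e3 e4 e5 *.
rewrite lte_fin in eta_gt1.
have erN0 : er != 0 by rewrite gt_eqF// (lt_trans ltr01).
rewrite inver (negbTE erN0) => k k1; rewrite hP hQ.
rewrite hP in P_ge; rewrite hQ in Q_ge.
apply: (psi_contraction hm htheta (convex_functionE f_convex) f_diff g_proper g_convex
  mu_gt0 g_strongly_convex f_partial_lip h_diff nu_gt0
  (strongly_convex_real h_strongly_convex) h_lip kkt hsampling hmethod etax_gt0 etay_gt0
  halpha gamma0 hrho beta_gt0 c_gt0 tau1_gt0 tau2_gt0 delta_ge0 delta_gt0 kappa_ge0
  gammaA gammaB A1 B1 delta_kappa P_ge Q_ge (ltW sigma0) sigma1 sigma_le (ltW eta_gt1)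
  _ _ _ _ _ k1).
- by apply: ediv_le e1 => //; lra.
- exact: adde_ediv_le (ltW a2_gt0) b2_ge0 e2.
- exact: adde_ediv_le (ltW a3_gt0) b3_ge0 e3.
- exact: adde_ediv_le (ltW a4_gt0) b4_ge0 e4.
- by move: e5; rewrite -EFinD lee_fin lerBlDl.
Qed.
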